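(* If $X$ is a uniformly one-dimensional geodesic space (e.g. if $X$ is a compact geodesic space with topological dimension $1$), then $\pi_{cl}(X)=1$ and $\bar{\pi}_1(X)=\pi_1(X)$.
   Context: A geodesic space is a metric space in which any two points are joined by a curve whose length equals the distance between them. A metric space $X$ has uniform dimension at most $n$ if every uniform open cover of $X$ (i.e. open cover with a positive Lebesgue number) is refined by a uniform open cover in which every point lies in at most $n+1$ elements; uniformly one-dimensional means uniform dimension $1$. Let $X$ be a geodesic space with base point $*$ (immaterial up to isomorphism). For $\varepsilon>0$, an $\varepsilon$-chain is a finite sequence $\{x_0,\dots,x_n\}$ in $X$ with $d(x_{i-1},x_i)<\varepsilon$ for all $i$. A basic move adds or removes one point, keeping the endpoints fixed and keeping the result an $\varepsilon$-chain; two $\varepsilon$-chains are $\varepsilon$-homotopic if connected by finitely many basic moves. $\pi_\varepsilon(X)$ is the group, under concatenation, of $\varepsilon$-homotopy classes of $\varepsilon$-chains that start and end at $*$. A strong $\varepsilon$-chain along a path $\gamma:[a,b]\to X$ is an $\varepsilon$-chain $\{\gamma(t_0),\dots,\gamma(t_n)\}$ for a partition $a=t_0<\dots<t_n=b$ with $\gamma([t_{i-1},t_i])\subset B_\varepsilon(\gamma(t_{i-1}))\cap B_\varepsilon(\gamma(t_i))$ for each $i$. The well-defined surjective homomorphism $h_\varepsilon:\pi_1(X)\to\pi_\varepsilon(X)$ sends $[\gamma]$ to the class of any strong $\varepsilon$-chain along $\gamma$. Put $K_\varepsilon=\ker h_\varepsilon$, $\pi_{cl}(X)=\bigcap_{\varepsilon>0}K_\varepsilon$,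 $\bar{\pi}_1(X)=\pi_1(X)/\pi_{cl}(X)$; ''$\pi_{cl}(X)=1$'' means it is the trivial subgroup. *)

(* Defs.v *)
From HB Require Import structures.
From Stdlib Require Import Relations.Relation_Operators.
From mathcomp Require Import all_boot all_order all_algebra generic_quotient.
From mathcomp Require Import mathcomp_extra boolp classical_sets functions.
From mathcomp Require Import cardinality reals ereal topology normedtype numfun.
From mathcomp Require Import lra.

Set Implicit Arguments.
Unset Strict Implicit.
Unset Printing Implicit Defensive.

Import Order.TTheory GRing.Theory Num.Theory.
Import numFieldTopology.Exports numFieldNormedType.Exports.

Local Open Scope classical_set_scope.
Local Open Scope quotient_scope.
Local Open Scope ring_scope.

Section within.
Context {T U V : topologicalType}.

Lemma within_continuous_comp (B : set T) (A : set U) (phi : T -> U)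
    (f : U -> V) :
  {within B, continuous phi} -> (forall x, B x -> A (phi x)) ->
  {within A, continuous f} -> {within B, continuous (fun x => f (phi x))}.
Proof.
move=> /subspace_continuousP cphi BA /subspace_continuousP cf.
apply/subspace_continuousP => x Bx W /= fW.
have /cphi h := Bx.
have := cf _ (BA _ Bx) W fW; rewrite /nbhs/= /within/= => h2.
have := h _ h2; rewrite /nbhs/= /within /=.
by apply: filterS => y + By => /(_ By); apply; exact: BA.
Qed.

Lemma within_continuous_eq (B : set T) (f g : T -> V) :
  (forall x, B x -> f x = g x) -> {within B, continuous f} ->
  {within B, continuous g}.
Proof.
by move=> fg; apply: subspace_eq_continuous => x; rewrite inE => /fg.
Qed.

End within.

Lemma continuous_pairT {T U V : topologicalType} (f : T -> U) (g : T -> V) :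
  continuous f -> continuous g -> continuous (fun x => (f x, g x)).
Proof. by move=> cf cg x; apply: (cvg_pair (cf x) (cg x)). Qed.

Lemma preimage_closedT {T U : topologicalType} (f : T -> U) (D : set U) :
  continuous f -> closed D -> closed (f @^-1` D).
Proof. by move=> cf; apply: preimage_closed => x _; exact: cf. Qed.

Lemma continuous_minT (R : realType) (f g : R -> R) : continuous f ->
  continuous g -> continuous (fun x => Num.min (f x) (g x)).
Proof. by move=> cf cg x; exact: (@continuous_min R R f g x (cf x) (cg x)). Qed.

Lemma continuous_maxT (R : realType) (f g : R -> R) : continuous f ->
  continuous g -> continuous (fun x => Num.max (f x) (g x)).
Proof. by move=> cf cg x; exact: (@continuous_max R R f g x (cf x) (cg x)). Qed.

Lemma within_continuous_if (R : realType) (T V : topologicalType) (B : set T)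
    (u : T -> R) (c : R) (f g : T -> V) :
  closed B -> continuous u ->
  {within B `&` [set x | u x <= c], continuous f} ->
  {within B `&` [set x | c <= u x], continuous g} ->
  (forall x, B x -> u x = c -> f x = g x) ->
  {within B, continuous (fun x => if u x <= c then f x else g x)}.
Proof.
move=> cB cu cf cg fg.
have -> : B = (B `&` [set x | u x <= c]) `|` (B `&` [set x | c <= u x]).
  rewrite -setIUr; apply/seteqP; split => [x Bx|x []//]; split => //=.
  by case: (leP (u x) c) => [|/ltW]; [left|right].
have cl1 : closed [set x | u x <= c].
  by apply: (preimage_closedT (D := [set y : R | y <= c])) => //; exact: closed_le.
have cl2 : closed [set x | c <= u x].
  by apply: (preimage_closedT (D := [set y : R | c <= y])) => //; exact: closed_ge.
apply: withinU_continuous; [exact: closedI|exact: closedI| |].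
- by apply: within_continuous_eq cf => x [_ /= ->].
- apply: within_continuous_eq cg => x [Bx /= cx]; case: ifPn => // xc.
  by rewrite fg//; apply/eqP; rewrite eq_le xc.
Qed.

Section homotopy.
Context {R : realType} {X : metricType R}.
Implicit Types (f g h : R -> X) (b : X).

Notation I := (`[0, 1]%classic : set R).

(* Homotopy relative to the endpoints; the second coordinate is the time. *)
Definition path_homotopic (f g : R -> X) : Prop :=
  exists H : R * R -> X,
    [/\ {within I `*` I, continuous H},
        (forall s, I s -> H (s, 0) = f s),
        (forall s, I s -> H (s, 1) = g s) &
        (forall t, I t -> H (0, t) = f 0 /\ H (1, t) = f 1)].

Definition path_concat f g : R -> X :=
  fun t => if t <= 2^-1 then f (2 * t) else g (2 * t - 1).

Definition path_rev f : R -> X := fun t => f (1 - t).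

Lemma unit_itvE t : I t = (0 <= t <= 1) :> Prop.
Proof. by rewrite /= in_itv. Qed.

Lemma unit_itv0 : I 0. Proof. by rewrite unit_itvE lexx ler01. Qed.
Lemma unit_itv1 : I 1. Proof. by rewrite unit_itvE lexx ler01. Qed.
Hint Resolve unit_itv0 unit_itv1 : core.

Lemma path_homotopic_refl f : {within I, continuous f} -> path_homotopic f f.
Proof.
move=> cf; exists (fun p => f p.1); split => //.
apply: within_continuous_comp cf; last by move=> [x y] [].
by apply: continuous_subspaceT => x; exact: cvg_fst.
Qed.

Lemma homotopy_right f g H : (forall s, I s -> H (s, 0) = f s) ->
  (forall s, I s -> H (s, 1) = g s) ->
  (forall t, I t -> H (0, t) = f 0 /\ H (1, t) = f 1) ->
  f 0 = g 0 /\ f 1 = g 1.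
Proof.
by move=> _ h1 /(_ 1 unit_itv1) [<- <-]; rewrite !h1.
Qed.

Lemma path_homotopic_sym f g : path_homotopic f g -> path_homotopic g f.
Proof.
case=> H [cH h0 h1 he]; have [e0 e1] := homotopy_right h0 h1 he.
exists (fun p => H (p.1, 1 - p.2)); split.
- apply: (within_continuous_comp _ _ cH); last first.
    by move=> [x y] /= []; rewrite !in_itv /= => -> /andP[? ?]; split => //; lra.
  apply: continuous_subspaceT; apply: continuous_pairT => x; first exact: cvg_fst.
  by apply: cvgB; [exact: cvg_cst|exact: cvg_snd].
- by move=> s Is /=; rewrite subr0 h1.
- by move=> s Is /=; rewrite subrr h0.
- move=> t It /=; rewrite -e0 -e1; apply: he; move: It; rewrite !unit_itvE; lra.
Qed.


Lemma closedII : closed (I `*` I).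
Proof.
have -> : I `*` I = (fst @^-1` I) `&` (snd @^-1` I) :> set (R * R) by [].
apply: closedI.
- by apply: preimage_closedT => [x|]; [exact: cvg_fst|exact: itv_closed].
- by apply: preimage_closedT => [x|]; [exact: cvg_snd|exact: itv_closed].
Qed.

Lemma path_homotopic_trans f g h :
  path_homotopic f g -> path_homotopic g h -> path_homotopic f h.
Proof.
case=> H [cH h0 h1 he] [K [cK k0 k1 ke]].
have [e0 e1] := homotopy_right h0 h1 he.
have ctt (a b : R) : continuous (fun p : R * R => (p.1, a * p.2 + b)).
  move=> //; apply: continuous_pairT => x; first exact: cvg_fst.
  by apply: cvgD; [apply: cvgMl_tmp; exact: cvg_snd|exact: cvg_cst].
exists (fun p => if p.2 <= 2^-1 then H (p.1, 2 * p.2 + 0)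
                 else K (p.1, 2 * p.2 + - 1)); split.
- apply: within_continuous_if; [exact: closedII|by move=> x; exact: cvg_snd| | |].
  + apply: (within_continuous_comp _ _ cH).
      by apply: continuous_subspaceT; exact: ctt.
    by move=> [x y] /= [] []; rewrite !in_itv /= => -> /andP[? ?] ?; split => //; lra.
  + apply: (within_continuous_comp _ _ cK).
      by apply: continuous_subspaceT; exact: ctt.
    by move=> [x y] /= [] []; rewrite !in_itv /= => -> /andP[? ?] ?; split => //; lra.
  + move=> [x y] /= [Ix _] ->; rewrite divff// addr0 subrr h1 ?k0//.
- by move=> s Is /=; rewrite invr_ge0 ler0n mulr0 addr0 h0.
- move=> s Is /=; rewrite ifF; last by apply/negP; lra.
  by rewrite mulr1 (_ : 2 - 1 = 1) ?k1//; lra.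
- move=> t /=; rewrite in_itv /= => It; case: ifPn => t2.
    by apply: he; rewrite unit_itvE; lra.
  by rewrite e0 e1; apply: ke; rewrite unit_itvE; lra.
Qed.

Lemma path_concat_continuous f g :
  {within I, continuous f} -> {within I, continuous g} -> f 1 = g 0 ->
  {within I, continuous (path_concat f g)}.
Proof.
move=> cf cg fg; have caff (a b : R) : continuous (fun x : R => a * x + b).
  by move=> x; apply: cvgD; [apply: cvgMl_tmp; exact: cvg_id|exact: cvg_cst].
apply: within_continuous_if; [exact: itv_closed|by move=> x; exact: cvg_id| | |].
- apply: (within_continuous_comp _ _ cf).
    by apply: continuous_subspaceT => x; apply: cvgMl_tmp; exact: cvg_id.
  by move=> x /= []; rewrite !in_itv /= => /andP[? ?] ?; lra.
- apply: (within_continuous_comp _ _ cg).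
    by apply: continuous_subspaceT => x; exact: caff.
  by move=> x /= []; rewrite !in_itv /= => /andP[? ?] ?; lra.
- by move=> x _ ->; rewrite divff// subrr.
Qed.

Lemma path_rev_continuous f : {within I, continuous f} ->
  {within I, continuous (path_rev f)}.
Proof.
move=> cf; apply: (within_continuous_comp _ _ cf).
  by apply: continuous_subspaceT => x; apply: cvgB; [exact: cvg_cst|exact: cvg_id].
by move=> x; rewrite !unit_itvE; lra.
Qed.

Lemma path_homotopic_concat f f' g g' : f 1 = g 0 ->
  path_homotopic f f' -> path_homotopic g g' ->
  path_homotopic (path_concat f g) (path_concat f' g').
Proof.
move=> fg [H [cH h0 h1 he]] [K [cK k0 k1 ke]].
have ctt (a b : R) : continuous (fun p : R * R => (a * p.1 + b, p.2)).
  move=> //; apply: continuous_pairT => x; last exact: cvg_snd.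
  by apply: cvgD; [apply: cvgMl_tmp; exact: cvg_fst|exact: cvg_cst].
exists (fun p => if p.1 <= 2^-1 then H (2 * p.1 + 0, p.2)
                 else K (2 * p.1 + - 1, p.2)); split.
- apply: within_continuous_if; [exact: closedII|by move=> x; exact: cvg_fst| | |].
  + apply: (within_continuous_comp _ _ cH).
      by apply: continuous_subspaceT; exact: ctt.
    by move=> [x y] /= [] []; rewrite !in_itv /= => /andP[? ?] -> ?; split => //; lra.
  + apply: (within_continuous_comp _ _ cK).
      by apply: continuous_subspaceT; exact: ctt.
    by move=> [x y] /= [] []; rewrite !in_itv /= => /andP[? ?] -> ?; split => //; lra.
  + move=> [x y] /= [_ Iy] ->; rewrite divff// addr0 subrr.
    by rewrite (he _ Iy).2 (ke _ Iy).1.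
- move=> s /=; rewrite in_itv /= /path_concat => ?; case: ifPn => ?.
    by rewrite addr0 h0// unit_itvE; lra.
  by rewrite k0// unit_itvE; lra.
- move=> s /=; rewrite in_itv /= /path_concat => ?; case: ifPn => ?.
    by rewrite addr0 h1// unit_itvE; lra.
  by rewrite k1// unit_itvE; lra.
- move=> t It /=; rewrite /path_concat invr_ge0 ler0n mulr0 addr0.
  have -> : (1 <= 2^-1 :> R) = false by apply/negP; lra.
  rewrite (he _ It).1 mulr1 (_ : 2 - 1 = 1); last lra.
  by rewrite (ke _ It).2.
Qed.

Lemma path_homotopic_rev f g : path_homotopic f g ->
  path_homotopic (path_rev f) (path_rev g).
Proof.
case=> H [cH h0 h1 he]; exists (fun p => H (1 - p.1, p.2)); split.
- apply: (within_continuous_comp _ _ cH).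
    apply: continuous_subspaceT; apply: continuous_pairT => x; last exact: cvg_snd.
    by apply: cvgB; [exact: cvg_cst|exact: cvg_fst].
  by move=> [x y] /= []; rewrite !in_itv /= => /andP[? ?] ->; split => //; lra.
- by move=> s; rewrite unit_itvE => Is /=; rewrite h0// unit_itvE; lra.
- by move=> s; rewrite unit_itvE => Is /=; rewrite h1// unit_itvE; lra.
- move=> t It /=; rewrite /path_rev subr0 subrr.
  by have [] := he _ It.
Qed.

Lemma path_homotopic_reparam f (phi psi : R -> R) :
  {within I, continuous f} -> continuous phi -> continuous psi ->
  (forall s, I s -> I (phi s)) -> (forall s, I s -> I (psi s)) ->
  phi 0 = psi 0 -> phi 1 = psi 1 ->
  path_homotopic (fun s => f (phi s)) (fun s => f (psi s)).
Proof.
move=> cf cphi cpsi Iphi Ipsi e0 e1.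
exists (fun p => f (phi p.1 + p.2 * (psi p.1 - phi p.1))); split.
- apply: (within_continuous_comp _ _ cf).
    have c1 (k : R -> R) : continuous k -> continuous (fun p : R * R => k p.1).
      move=> ck x; apply: (@continuous_comp _ _ _ fst k); first exact: cvg_fst.
      exact: ck.
    apply: continuous_subspaceT => x; apply: cvgD; first exact: c1.
    apply: cvgM; first exact: cvg_snd.
    by apply: cvgB; exact: c1.
  move=> [x y] /= []; rewrite !in_itv /= => Ix Iy.
  have := Iphi x; have := Ipsi x; rewrite !unit_itvE => /(_ Ix) ? /(_ Ix) ?; nra.
- by move=> s _; rewrite /= mul0r addr0.
- by move=> s _; rewrite /= mul1r addrC subrK.
- by move=> t _; rewrite /= e0 e1 !subrr !mulr0 !addr0.
Qed.

Lemma path_homotopic_eq f g : {within I, continuous f} ->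
  (forall s, I s -> f s = g s) -> path_homotopic f g.
Proof.
move=> cf fg; have [H [cH h0 h1 he]] := path_homotopic_refl cf.
by exists H; split => // s Is; rewrite h1// fg.
Qed.

Lemma path_concatA f g h : {within I, continuous f} ->
  {within I, continuous g} -> {within I, continuous h} ->
  f 1 = g 0 -> g 1 = h 0 ->
  path_homotopic (path_concat f (path_concat g h))
                 (path_concat (path_concat f g) h).
Proof.
move=> cf cg ch fg gh.
have gh0 : path_concat g h 0 = g 0.
  by rewrite /path_concat invr_ge0 ler0n mulr0.
have cfgh : {within I, continuous (path_concat f (path_concat g h))}.
  by apply: path_concat_continuous => //; [exact: path_concat_continuous|rewrite gh0].
pose phi (s : R) := Num.min (2 * s) (Num.min (s + 4^-1) (2^-1 * s + 2^-1)).
have cphi : continuous phi.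
  apply: continuous_minT => x; first by apply: cvgMl_tmp; exact: cvg_id.
  move: x; apply: continuous_minT => x; first by apply: cvgD; [exact: cvg_id|exact: cvg_cst].
  by apply: cvgD; [apply: cvgMl_tmp; exact: cvg_id|exact: cvg_cst].
apply: path_homotopic_trans (path_homotopic_reparam (phi := id) (psi := phi) cfgh _ cphi _ _ _ _) _.
- by move=> x; exact: cvg_id.
- by [].
- move=> s; rewrite !unit_itvE /phi => ?; rewrite !le_min !ge_min; lra.
- by rewrite /phi [RHS](min_idPl _) ?le_min; lra.
- by rewrite /phi !(min_idPr _); lra.
apply: path_homotopic_eq.
  by apply: (within_continuous_comp _ _ cfgh);
    [exact: continuous_subspaceT|move=> s; rewrite !unit_itvE /phi => ?; rewrite !le_min !ge_min; lra].
move=> s; rewrite unit_itvE => Is.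
have [s4|s4] := leP s (4^-1).
  have -> : phi s = 2 * s by rewrite /phi; apply/min_idPl; rewrite !le_min; lra.
  rewrite /path_concat; rewrite ifT; last lra.
  by rewrite ifT; last lra; rewrite ifT//; lra.
have [s2|s2] := leP s (2^-1).
  have -> : phi s = s + 4^-1.
    rewrite /phi; rewrite (min_idPl _ (x := s + _)); last lra.
    by apply/min_idPr; lra.
  rewrite /path_concat; rewrite ifF; last by apply/negbTE; rewrite -ltNge; lra.
  rewrite ifT; last lra.
  rewrite ifT; last lra.
  rewrite ifF; last by apply/negbTE; rewrite -ltNge; lra.
  by congr g; lra.
have -> : phi s = 2^-1 * s + 2^-1.
  by rewrite /phi (min_idPr _ (x := s + _)) ?(min_idPr _ (x := 2 * s))//; lra.
rewrite /path_concat; rewrite ifF; last by apply/negbTE; rewrite -ltNge; lra.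
rewrite ifF; last by apply/negbTE; rewrite -ltNge; lra.
rewrite ifF; last by apply/negbTE; rewrite -ltNge; lra.
by congr h; lra.
Qed.

Lemma path_concat1p f g b : {within I, continuous f} -> f 0 = b ->
  g = cst b -> path_homotopic (path_concat g f) f.
Proof.
move=> cf f0 ->; apply: path_homotopic_sym.
pose phi (s : R) := Num.max 0 (2 * s - 1).
have cphi : continuous phi.
  apply: (continuous_maxT (f := cst 0)) => x; first exact: cvg_cst.
  by apply: cvgB; [apply: cvgMl_tmp; exact: cvg_id|exact: cvg_cst].
have Iphi s : I s -> I (phi s).
  by rewrite !unit_itvE /phi => ?; rewrite !ge_max !le_max; lra.
apply: path_homotopic_trans (path_homotopic_reparam (phi := id) (psi := phi) cf _ cphi _ Iphi _ _) _ => //.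
- by move=> x; exact: cvg_id.
- by rewrite /phi maxEle; case: ifPn => ?; lra.
- by rewrite /phi maxEle; case: ifPn => ?; lra.
apply: path_homotopic_eq.
  by apply: (within_continuous_comp _ _ cf) => //; exact: continuous_subspaceT.
move=> s; rewrite unit_itvE => Is; rewrite /path_concat /phi; case: ifPn => s2.
  by rewrite (max_idPl _) ?f0//; lra.
by rewrite (max_idPr _)//; lra.
Qed.

Lemma path_concatp1 f g b : {within I, continuous f} -> f 1 = b ->
  g = cst b -> path_homotopic (path_concat f g) f.
Proof.
move=> cf f1 ->; apply: path_homotopic_sym.
pose phi (s : R) := Num.min (2 * s) 1.
have cphi : continuous phi.
  apply: (continuous_minT (g := cst 1)) => x; last exact: cvg_cst.
  by apply: cvgMl_tmp; exact: cvg_id.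
have Iphi s : I s -> I (phi s).
  by rewrite !unit_itvE /phi => ?; rewrite !ge_min !le_min; lra.
apply: path_homotopic_trans (path_homotopic_reparam (phi := id) (psi := phi) cf _ cphi _ Iphi _ _) _ => //.
- by move=> x; exact: cvg_id.
- by rewrite /phi minEle; case: ifPn => ?; lra.
- by rewrite /phi minEle; case: ifPn => ?; lra.
apply: path_homotopic_eq.
  by apply: (within_continuous_comp _ _ cf) => //; exact: continuous_subspaceT.
move=> s; rewrite unit_itvE => Is; rewrite /path_concat /phi; case: ifPn => s2.
  by rewrite (min_idPl _)//; lra.
by rewrite (min_idPr _) ?f1//; lra.
Qed.

Lemma path_concatpV f b : {within I, continuous f} -> f 0 = b ->
  path_homotopic (path_concat f (path_rev f)) (cst b).
Proof.
move=> cf f0; apply: path_homotopic_sym.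
pose phi (s : R) := Num.min (2 * s) (2 - 2 * s).
have cphi : continuous phi.
  apply: continuous_minT => x; first by apply: cvgMl_tmp; exact: cvg_id.
  by apply: cvgB; [exact: cvg_cst|apply: cvgMl_tmp; exact: cvg_id].
have Iphi s : I s -> I (phi s).
  by rewrite !unit_itvE /phi => ?; rewrite !ge_min !le_min; lra.
have -> : cst b = (fun s => f ((cst 0 : R -> R) s)) by apply/funext => s; rewrite /= f0.
apply: path_homotopic_trans (path_homotopic_reparam (phi := cst 0) (psi := phi) cf _ cphi _ Iphi _ _) _ => //.
- by move=> x; exact: cvg_cst.
- by rewrite /phi /cst minEle; case: ifPn => ?; lra.
- by rewrite /phi /cst minEle; case: ifPn => ?; lra.
apply: path_homotopic_eq.
  by apply: (within_continuous_comp _ _ cf) => //; exact: continuous_subspaceT.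
move=> s; rewrite unit_itvE => Is; rewrite /path_concat /path_rev /phi; case: ifPn => s2.
  by rewrite (min_idPl _)//; lra.
by rewrite (min_idPr _)//; [congr f|]; lra.
Qed.

Lemma path_revK f : path_rev (path_rev f) = f.
Proof. by apply/funext => t; rewrite /path_rev opprB addrC subrK. Qed.

End homotopy.

Section fundamental_group.
Context {R : realType} {X : metricType R}.

Notation I := (`[0, 1]%classic : set R).

Record loop (b : X) := Loop {
  loop_fun :> R -> X;
  loop_continuous : {within I, continuous loop_fun};
  loop_start : loop_fun 0 = b;
  loop_end : loop_fun 1 = b }.

HB.instance Definition _ (b : X) := gen_eqMixin (loop b).
HB.instance Definition _ (b : X) := gen_choiceMixin (loop b).

Variable b : X.
Implicit Types f g h : loop b.

Definition loop_homotopic f g : bool := `[< path_homotopic f g >].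

Lemma loop_homotopic_refl : reflexive loop_homotopic.
Proof. by move=> f; apply/asboolP/path_homotopic_refl/loop_continuous. Qed.

Lemma loop_homotopic_sym : symmetric loop_homotopic.
Proof.
by move=> f g; apply/asboolP/asboolP; exact: path_homotopic_sym.
Qed.

Lemma loop_homotopic_trans : transitive loop_homotopic.
Proof.
move=> g f h /asboolP fg /asboolP gh; apply/asboolP.
exact: path_homotopic_trans fg gh.
Qed.

Canonical loop_homotopic_equiv := EquivRel loop_homotopic loop_homotopic_refl
  loop_homotopic_sym loop_homotopic_trans.

Definition pi1 := {eq_quot loop_homotopic}.
HB.instance Definition _ := Choice.on pi1.
HB.instance Definition _ := EqQuotient.on pi1.

Lemma pi1P f g : \pi_pi1 f = \pi_pi1 g <-> path_homotopic f g.
Proof.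
by split=> [/eqmodP/asboolP//|fg]; apply/eqmodP/asboolP.
Qed.

Lemma repr_pi1 f : path_homotopic (repr (\pi_pi1 f)) f.
Proof. by apply/pi1P; rewrite reprK. Qed.

Lemma loop_one_subproof : {within I, continuous (cst b : R -> X)}.
Proof. by apply: continuous_subspaceT => x; exact: cvg_cst. Qed.

Definition loop_one := Loop loop_one_subproof erefl erefl.

Lemma loop_mul_subproof f g : [/\ {within I, continuous (path_concat f g)},
  path_concat f g 0 = b & path_concat f g 1 = b].
Proof.
split.
- apply: path_concat_continuous; [exact: loop_continuous..|].
  by rewrite loop_start loop_end.
- by rewrite /path_concat invr_ge0 ler0n mulr0 loop_start.
- rewrite /path_concat ifF; last by apply/negP; lra.
  by rewrite mulr1 (_ : 2 - 1 = 1) ?loop_end//; lra.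
Qed.

Definition loop_mul f g := let: And3 c s e := loop_mul_subproof f g in
  Loop c s e.

Lemma loop_mulE f g : loop_mul f g = path_concat f g :> (R -> X).
Proof. by rewrite /loop_mul; case: loop_mul_subproof. Qed.

Lemma loop_inv_start f : path_rev f 0 = b.
Proof. by rewrite /path_rev subr0 loop_end. Qed.

Lemma loop_inv_end f : path_rev f 1 = b.
Proof. by rewrite /path_rev subrr loop_start. Qed.

Definition loop_inv f := Loop (path_rev_continuous (loop_continuous (l := f)))
  (loop_inv_start f) (loop_inv_end f).

Definition pi1_one : pi1 := \pi_pi1 loop_one.
Definition pi1_mul (x y : pi1) : pi1 := \pi_pi1 (loop_mul (repr x) (repr y)).
Definition pi1_inv (x : pi1) : pi1 := \pi_pi1 (loop_inv (repr x)).

Lemma pi1_mulE f g :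
  pi1_mul (\pi_pi1 f) (\pi_pi1 g) = \pi_pi1 (loop_mul f g).
Proof.
apply/pi1P; rewrite !loop_mulE; apply: path_homotopic_concat.
- by rewrite loop_start loop_end.
- exact: repr_pi1.
- exact: repr_pi1.
Qed.

Lemma pi1_mulA : associative pi1_mul.
Proof.
elim/quotW => f; elim/quotW => g; elim/quotW => h.
rewrite (pi1_mulE g h) (pi1_mulE f g) !pi1_mulE.
apply/pi1P; rewrite !loop_mulE.
by apply: path_concatA; rewrite ?loop_start ?loop_end//; exact: loop_continuous.
Qed.

Lemma pi1_mul1 : left_id pi1_one pi1_mul.
Proof.
elim/quotW => f; rewrite pi1_mulE; apply/pi1P; rewrite loop_mulE.
by apply: path_concat1p; [exact: loop_continuous|exact: loop_start|].
Qed.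

Lemma pi1_mulr1 : right_id pi1_one pi1_mul.
Proof.
elim/quotW => f; rewrite pi1_mulE; apply/pi1P; rewrite loop_mulE.
by apply: path_concatp1; [exact: loop_continuous|exact: loop_end|].
Qed.

Lemma pi1_mulV : right_inverse pi1_one pi1_inv pi1_mul.
Proof.
move=> x; rewrite -{1}[x]reprK /pi1_inv pi1_mulE.
apply/pi1P; rewrite loop_mulE.
by apply: path_concatpV; [exact: loop_continuous|exact: loop_start].
Qed.

Lemma pi1_mulVl : left_inverse pi1_one pi1_inv pi1_mul.
Proof.
move=> x; rewrite -{2}[x]reprK /pi1_inv pi1_mulE.
apply/pi1P; rewrite loop_mulE -[X in path_concat _ X]path_revK.
by apply: path_concatpV; [exact: loop_continuous|exact: loop_start].
Qed.

HB.instance Definition _ := isGroup.Build pi1 pi1_mulA pi1_mul1 pi1_mulr1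
  pi1_mulVl pi1_mulV.

Lemma mul_pi1 f g : (\pi_pi1 f * \pi_pi1 g)%g = \pi_pi1 (loop_mul f g).
Proof. exact: pi1_mulE. Qed.

End fundamental_group.

Section eps_chains.
Context {R : realType} {X : metricType R}.
Implicit Types (e : R) (x y z : X) (p q r : seq X).

(* The ε-chain {x, p_1, ..., p_n} from x to y is encoded by its tail
   [:: p_1; ...; p_n]. *)
Definition eps_chain e x y p : bool :=
  path (fun u v => mdist u v < e) x p && (last x p == y).

Lemma eps_chain_nil e x y : eps_chain e x y [::] = (x == y).
Proof. by []. Qed.

Lemma eps_chain_cons e x y z p :
  eps_chain e x y (z :: p) = (mdist x z < e) && eps_chain e z y p.
Proof. by rewrite /eps_chain /= andbA. Qed.

Definition adds_point p q : Prop :=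
  exists p1 p2 z, p = p1 ++ p2 /\ q = p1 ++ z :: p2.

Definition basic_move e x y p q : Prop :=
  [/\ eps_chain e x y p, eps_chain e x y q & adds_point p q \/ adds_point q p].

Definition eps_homotopic e x y : seq X -> seq X -> Prop :=
  clos_refl_trans _ (basic_move e x y).

Lemma basic_move_sym e x y p q : basic_move e x y p q -> basic_move e x y q p.
Proof. by case=> cp cq h; split => //; case: h; [right|left]. Qed.

Lemma eps_homotopic_refl e x y p : eps_homotopic e x y p p.
Proof. exact: rt_refl. Qed.

Lemma eps_homotopic_sym e x y p q :
  eps_homotopic e x y p q -> eps_homotopic e x y q p.
Proof.
elim=> {p q} [p q /basic_move_sym|p|p q r _ qp _ rq].
- exact: rt_step.
- exact: rt_refl.
- exact: rt_trans rq qp.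
Qed.

Lemma eps_homotopic_trans e x y q p r :
  eps_homotopic e x y p q -> eps_homotopic e x y q r -> eps_homotopic e x y p r.
Proof. exact: rt_trans. Qed.

Lemma eps_homotopic_add e x y p1 z p2 : eps_chain e x y (p1 ++ p2) ->
  eps_chain e x y (p1 ++ z :: p2) ->
  eps_homotopic e x y (p1 ++ p2) (p1 ++ z :: p2).
Proof. by move=> c1 c2; apply: rt_step; split => //; left; exists p1, p2, z. Qed.

Lemma eps_homotopic_del e x y p1 z p2 : eps_chain e x y (p1 ++ p2) ->
  eps_chain e x y (p1 ++ z :: p2) ->
  eps_homotopic e x y (p1 ++ z :: p2) (p1 ++ p2).
Proof. by move=> ? ?; apply/eps_homotopic_sym/eps_homotopic_add. Qed.

Lemma eps_chain_cat e x y z p q : eps_chain e x y p -> eps_chain e y z q ->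
  eps_chain e x z (p ++ q).
Proof.
move=> /andP[cp /eqP lp] /andP[cq /eqP lq].
by rewrite /eps_chain cat_path last_cat lp cp cq lq eqxx.
Qed.

Lemma eps_homotopic_catl e x y z p q r : eps_chain e x y r ->
  eps_homotopic e y z p q -> eps_homotopic e x z (r ++ p) (r ++ q).
Proof.
move=> cr; elim=> {p q} [p q [cp cq h]|p|p q s _ h1 _ h2].
- apply: rt_step; split; [exact: eps_chain_cat cp|exact: eps_chain_cat cq|].
  by case: h => -[p1 [p2 [w [-> ->]]]]; [left|right];
    exists (r ++ p1), p2, w; rewrite !catA.
- exact: rt_refl.
- exact: rt_trans h1 h2.
Qed.

Lemma eps_homotopic_catr e x y z p q r : eps_chain e y z r ->
  eps_homotopic e x y p q -> eps_homotopic e x z (p ++ r) (q ++ r).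
Proof.
move=> cr; elim=> {p q} [p q [cp cq h]|p|p q s _ h1 _ h2].
- apply: rt_step; split; [exact: eps_chain_cat cp cr|exact: eps_chain_cat cq cr|].
  by case: h => -[p1 [p2 [w [-> ->]]]]; [left|right];
    exists p1, (p2 ++ r), w; rewrite -!catA.
- exact: rt_refl.
- exact: rt_trans h1 h2.
Qed.

Definition chain_rev x p : seq X := rev (belast x p).

Lemma eps_chain_rev e x y p : eps_chain e x y p -> eps_chain e y x (chain_rev x p).
Proof.
move=> /andP[cp /eqP <-]; rewrite /eps_chain /chain_rev rev_path.
rewrite (eq_path (e' := fun u v => mdist u v < e)) ?cp/=; last first.
  by move=> u v /=; rewrite metric_sym.
by case: p {cp} => //= z p; rewrite rev_cons last_rcons.
Qed.


Lemma chain_rev_loop x p : last x p = x -> chain_rev x (chain_rev x p) = p.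
Proof.
move=> lp; rewrite /chain_rev; case/lastP: p lp => [//|p z].
rewrite last_rcons => ->; rewrite belast_rcons rev_cons belast_rcons.
by rewrite rev_cons revK.
Qed.

Lemma eps_homotopic_revr e x p : path (fun u v => mdist u v < e) x p ->
  eps_homotopic e x x (p ++ chain_rev x p) [::].
Proof.
elim/last_ind: p => [|p z IH]; first by move=> _; exact: rt_refl.
rewrite rcons_path => /andP[cp lz].
have e0 : 0 < e by apply: le_lt_trans lz; exact: mdist_ge0.
apply: eps_homotopic_trans (IH cp).
have cpl : eps_chain e x (last x p) p by rewrite /eps_chain cp eqxx.
have crev := eps_chain_rev cpl.
have c0 := eps_chain_cat cpl crev.
have c1 : eps_chain e x x (p ++ last x p :: chain_rev x p).
  apply: eps_chain_cat cpl _.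
  by move: crev; rewrite /eps_chain /= mdistxx e0.
have -> : rcons p z ++ chain_rev x (rcons p z)
        = p ++ z :: last x p :: chain_rev x p.
  by rewrite /chain_rev belast_rcons lastI rev_rcons cat_rcons.
apply: eps_homotopic_trans (eps_homotopic_del c0 c1).
apply: eps_homotopic_del => //; apply: eps_chain_cat cpl _.
by move: crev; rewrite /eps_chain /= lz metric_sym lz.
Qed.

End eps_chains.

Section pi_eps.
Context {R : realType} {X : metricType R}.
Variables (e : R) (b : X).

Definition eps_loop := {p : seq X | eps_chain e b b p}.
HB.instance Definition _ := Choice.on eps_loop.
HB.instance Definition _ := SubType.on eps_loop.

Definition eps_loop_homotopic (p q : eps_loop) : bool :=
  `[< eps_homotopic e b b (val p) (val q) >].

Lemma eps_loop_homotopic_refl : reflexive eps_loop_homotopic.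
Proof. by move=> p; apply/asboolP; exact: eps_homotopic_refl. Qed.

Lemma eps_loop_homotopic_sym : symmetric eps_loop_homotopic.
Proof. by move=> p q; apply/asboolP/asboolP; exact: eps_homotopic_sym. Qed.

Lemma eps_loop_homotopic_trans : transitive eps_loop_homotopic.
Proof.
move=> q p r /asboolP pq /asboolP qr; apply/asboolP.
exact: eps_homotopic_trans pq qr.
Qed.

Canonical eps_loop_homotopic_equiv := EquivRel eps_loop_homotopic
  eps_loop_homotopic_refl eps_loop_homotopic_sym eps_loop_homotopic_trans.

Definition pi_eps := {eq_quot eps_loop_homotopic}.
HB.instance Definition _ := Choice.on pi_eps.
HB.instance Definition _ := EqQuotient.on pi_eps.

Lemma pi_epsP p q : \pi_pi_eps p = \pi_pi_eps q <->
  eps_homotopic e b b (val p) (val q).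
Proof. by split=> [/eqmodP/asboolP//|pq]; apply/eqmodP/asboolP. Qed.

Lemma repr_pi_eps p : eps_homotopic e b b (val (repr (\pi_pi_eps p))) (val p).
Proof. by apply/pi_epsP; rewrite reprK. Qed.

Lemma eps_loop_one_subproof : eps_chain e b b [::].
Proof. by rewrite /eps_chain /= eqxx. Qed.

Definition eps_loop_one : eps_loop := Sub [::] eps_loop_one_subproof.

Definition eps_loop_mul (p q : eps_loop) : eps_loop :=
  Sub (val p ++ val q) (eps_chain_cat (valP p) (valP q)).

Definition eps_loop_inv (p : eps_loop) : eps_loop :=
  Sub (chain_rev b (val p)) (eps_chain_rev (valP p)).

Lemma val_eps_loop_one : val eps_loop_one = [::]. Proof. by []. Qed.

Lemma val_eps_loop_mul p q : val (eps_loop_mul p q) = val p ++ val q.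
Proof. by []. Qed.

Lemma val_eps_loop_inv p : val (eps_loop_inv p) = chain_rev b (val p).
Proof. by []. Qed.

Definition pi_eps_one : pi_eps := \pi_pi_eps eps_loop_one.
Definition pi_eps_mul (x y : pi_eps) : pi_eps :=
  \pi_pi_eps (eps_loop_mul (repr x) (repr y)).
Definition pi_eps_inv (x : pi_eps) : pi_eps := \pi_pi_eps (eps_loop_inv (repr x)).

Lemma pi_eps_mulE p q :
  pi_eps_mul (\pi_pi_eps p) (\pi_pi_eps q) = \pi_pi_eps (eps_loop_mul p q).
Proof.
apply/pi_epsP; rewrite !val_eps_loop_mul.
apply: eps_homotopic_trans (eps_homotopic_catl (valP p) (repr_pi_eps q)).
apply: eps_homotopic_catr (repr_pi_eps p); exact: valP.
Qed.

Lemma pi_eps_mulA : associative pi_eps_mul.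
Proof.
elim/quotW => p; elim/quotW => q; elim/quotW => r.
rewrite (pi_eps_mulE q r) (pi_eps_mulE p q) !pi_eps_mulE.
by congr (\pi_pi_eps _); apply/val_inj; rewrite !val_eps_loop_mul catA.
Qed.

Lemma pi_eps_mul1 : left_id pi_eps_one pi_eps_mul.
Proof.
elim/quotW => p; rewrite pi_eps_mulE.
by congr (\pi_pi_eps _); apply/val_inj; rewrite val_eps_loop_mul.
Qed.

Lemma pi_eps_mulr1 : right_id pi_eps_one pi_eps_mul.
Proof.
elim/quotW => p; rewrite pi_eps_mulE.
by congr (\pi_pi_eps _); apply/val_inj; rewrite val_eps_loop_mul cats0.
Qed.

Lemma pi_eps_mulV : right_inverse pi_eps_one pi_eps_inv pi_eps_mul.
Proof.
move=> x; rewrite -{1}[x]reprK /pi_eps_inv pi_eps_mulE.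
apply/pi_epsP; rewrite val_eps_loop_mul val_eps_loop_inv; apply: eps_homotopic_revr.
by case/andP: (valP (repr x)).
Qed.

Lemma pi_eps_mulVl : left_inverse pi_eps_one pi_eps_inv pi_eps_mul.
Proof.
move=> x; rewrite -{2}[x]reprK /pi_eps_inv pi_eps_mulE.
apply/pi_epsP; rewrite val_eps_loop_mul val_eps_loop_inv.
have /andP[_ /eqP lx] := valP (repr x).
rewrite -{2}(chain_rev_loop lx); apply: eps_homotopic_revr.
by have /andP[] := eps_chain_rev (valP (repr x)).
Qed.

HB.instance Definition _ := isGroup.Build pi_eps pi_eps_mulA pi_eps_mul1
  pi_eps_mulr1 pi_eps_mulVl pi_eps_mulV.

Lemma mul_pi_eps (p q : eps_loop) :
  (\pi_pi_eps p * \pi_pi_eps q)%g = \pi_pi_eps (eps_loop_mul p q).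
Proof. exact: pi_eps_mulE. Qed.

End pi_eps.

Section iota_path.
Context {T : Type}.

Lemma path_map_iota (r : rel T) (g : nat -> T) m n :
  (forall i, (m <= i < m + n)%N -> r (g i) (g i.+1)) ->
  path r (g m) [seq g i | i <- iota m.+1 n].
Proof.
elim: n m => //= n IH m h; rewrite h ?leqnn ?addnS ?ltnS ?leq_addr//=.
apply: IH => i /andP[mi im]; apply: h; rewrite (ltnW mi)/=.
by rewrite -addSnnS.
Qed.

Lemma last_map_iota (g : nat -> T) m n :
  last (g m) [seq g i | i <- iota m.+1 n] = g (m + n)%N.
Proof. by elim: n m => /= [m|n IH m]; rewrite ?addn0// IH addSnnS. Qed.

End iota_path.

Section strong_chains.
Context {R : realType} {X : metricType R}.
Implicit Types (e a b s t : R) (f g : R -> X) (x y z : X).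

Notation I := (`[0, 1]%classic : set R).

Definition strong_step e f s t : Prop :=
  f @` `[s, t] `<=` ball (f s) e `&` ball (f t) e.

Definition strong_partition e f a b (ts : seq R) : Prop :=
  itv_partition a b ts /\
  path (fun s t => `[< strong_step e f s t >]) a ts.

(* As for ε-chains, the initial point f a is left implicit in c. *)
Definition strong_eps_chain e f a b (c : seq X) : Prop :=
  exists2 ts, strong_partition e f a b ts & c = map f ts.

Lemma strong_stepP e f s t : strong_step e f s t <->
  (forall u, s <= u <= t -> mdist (f s) (f u) < e /\ mdist (f t) (f u) < e).
Proof.
split=> [h u ut|h z [u /=]].
  have : (f @` `[s, t]) (f u) by exists u => //=; rewrite in_itv.
  by move=> /h; rewrite !ballEmdist.
by rewrite in_itv /= => /h ? <-; rewrite !ballEmdist.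
Qed.

Lemma strong_partition_nil e f a b : strong_partition e f a b [::] <-> a = b.
Proof.
by split=> [[/itv_partition_nil]//|->]; split => //; split => //=.
Qed.

Lemma strong_partition_cons e f a b t ts :
  strong_partition e f a b (t :: ts) <->
  [/\ a < t, strong_step e f a t & strong_partition e f t b ts].
Proof.
split.
  by move=> [[/= /andP[at_ p] l] /andP[/asboolP s q]].
by move=> [at_ s [[p l] q]]; split => /=; [split; rewrite /= ?at_|rewrite asboolT].
Qed.

Lemma strong_partition_le e f a b ts : strong_partition e f a b ts -> a <= b.
Proof. by case=> /itv_partition_le. Qed.

Lemma strong_partition_chain e f a b ts : strong_partition e f a b ts ->
  eps_chain e (f a) (f b) (map f ts).
Proof.
elim: ts a => [a /strong_partition_nil ->|t ts IH a].
  by rewrite /eps_chain /= eqxx.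
move=> /strong_partition_cons[at_ /strong_stepP st /IH].
rewrite /= eps_chain_cons => ->; rewrite andbT.
by have [] := st t; rewrite ?lexx ?ltW.
Qed.

Lemma strong_eps_chainW e f a b c : strong_eps_chain e f a b c ->
  eps_chain e (f a) (f b) c.
Proof. by move=> [ts /strong_partition_chain h ->]. Qed.

(* Condition on t :: ts as a partition of [w, b] that is strong except that
   nothing is required of ball (f w) e on the first interval. *)
Definition semi_strong e f w b (ts : seq R) : Prop :=
  if ts is t :: ts' then
    [/\ w < t, forall u, w <= u <= t -> mdist (f t) (f u) < e &
        strong_partition e f t b ts']
  else w = b.

Lemma strong_semi e f w b ts :
  strong_partition e f w b ts -> semi_strong e f w b ts.
Proof.
case: ts => [|t ts] /=; first by move/strong_partition_nil.
move=> /strong_partition_cons[wt /strong_stepP st p]; split => //.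
by move=> u /st[].
Qed.

Lemma semi_strong_chain e f w b ts : semi_strong e f w b ts ->
  eps_chain e (f w) (f b) (map f ts).
Proof.
case: ts => [/= ->|t ts [wt h /strong_partition_chain]].
  by rewrite /eps_chain /= eqxx.
by rewrite /= eps_chain_cons => ->; rewrite andbT metric_sym h// lexx ltW.
Qed.

Lemma semi_strong_homotopic e f w b ts ss :
  semi_strong e f w b ts -> semi_strong e f w b ss ->
  eps_homotopic e (f w) (f b) (map f ts) (map f ss).
Proof.
have [n] := ubnP (size ts + size ss)%N.
elim: n w ts ss => // n IH w ts ss.
wlog: ts ss / (if ts is t :: _ then if ss is s :: _ then t <= s else True
               else True).
  move=> wl; case: ts => [|t ts]; first exact: wl.
  case: ss => [|s ss]; first exact: wl.
  have [ts_le|/ltW st_le] := leP t s; first exact: wl.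
  by move=> ? ? ?; apply: eps_homotopic_sym; apply: wl => //; rewrite addnC.
case: ts => [|t ts] ts_le sz.
  case: ss {ts_le} sz => [|s ss] _; first by move=> *; exact: rt_refl.
  move=> /= -> [bs _ /strong_partition_le sb].
  by move: bs; rewrite ltNge sb.
case: ss ts_le sz => [|s ss] ts_le sz.
  move=> /= [bs _ /strong_partition_le sb] wb.
  by move: bs; rewrite ltNge wb sb.
move=> ht hs; have ct := semi_strong_chain ht; have cs := semi_strong_chain hs.
move: ht hs => [wt tP pts] [ws sP pss].
have wt1 : eps_chain e (f w) (f t) [:: f t].
  by move: ct; rewrite /= !eps_chain_cons eps_chain_nil eqxx andbT => /andP[].
have [ts_eq|ts_neq] := eqVneq t s.
  rewrite -ts_eq /=; apply: (eps_homotopic_catl (r := [:: f t]) wt1).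
  rewrite -ts_eq in pss.
  apply: IH; [by move: sz => /=; rewrite addSn addnS !ltnS => /ltnW|
    exact: strong_semi..].
have {ts_neq}ts_lt : t < s by rewrite lt_neqAle ts_neq.
have hs' : semi_strong e f t b (s :: ss).
  split => // u /andP[tu us]; apply: sP; rewrite us andbT.
  by rewrite (le_trans _ tu)// ltW.
have cs' := semi_strong_chain hs'.
have : eps_homotopic e (f w) (f b) (map f (t :: ts)) (map f (t :: s :: ss)).
  apply: (eps_homotopic_catl (p := map f ts) (q := map f (s :: ss)) wt1).
  have sz' : (size ts + size (s :: ss) < n)%N by move: sz; rewrite /= addSn ltnS.
  by have := IH _ _ _ sz' (strong_semi pts) hs'.
move=> /eps_homotopic_trans; apply.
apply: (eps_homotopic_del (p1 := [::])) => //.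
exact: (eps_chain_cat wt1 cs').
Qed.

Lemma strong_eps_chain_unique e f a b p q : strong_eps_chain e f a b p ->
  strong_eps_chain e f a b q -> eps_homotopic e (f a) (f b) p q.
Proof.
move=> [ts ? ->] [ss ? ->].
by apply: semi_strong_homotopic; exact: strong_semi.
Qed.

Lemma strong_partition_affine e f g k c a b ts : 0 < k ->
  (forall u, a <= u <= b -> g (k * u + c) = f u) ->
  strong_partition e f a b ts ->
  strong_partition e g (k * a + c) (k * b + c) [seq k * t + c | t <- ts] /\
  map g [seq k * t + c | t <- ts] = map f ts.
Proof.
move=> k0; elim: ts a => [a _ /strong_partition_nil ->|t ts IH a gf].
  by split => //; apply/strong_partition_nil.
move=> /strong_partition_cons[at_ st pt].
have tb := strong_partition_le pt.
have gf' u : t <= u <= b -> g (k * u + c) = f u.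
  by move=> /andP[tu ub]; apply: gf; rewrite ub (le_trans _ tu)// ltW.
have [IH1 IH2] := IH _ gf' pt; split; last first.
  by rewrite /= IH2 gf// tb ltW.
apply/strong_partition_cons; split => //.
  by rewrite ltrD2r ltr_pM2l.
apply/strong_stepP => v /andP[av vt].
have [u uE] : exists u, v = k * u + c.
  by exists (k^-1 * (v - c)); rewrite mulrA divff ?gt_eqF// mul1r subrK.
rewrite uE in av vt *.
have au : a <= u by move: av; rewrite lerD2r ler_pM2l.
have ut : u <= t by move: vt; rewrite lerD2r ler_pM2l.
have ab : a <= b by rewrite (le_trans _ tb)// ltW.
rewrite !gf ?lexx ?ab ?(ltW at_) ?tb ?au ?(le_trans ut tb)//.
by move/strong_stepP: st; apply; rewrite au.
Qed.

Lemma strong_partition_cat e f a b c ts ss : strong_partition e f a b ts ->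
  strong_partition e f b c ss -> strong_partition e f a c (ts ++ ss).
Proof.
move=> [h1 p1] [h2 p2]; split; first exact: itv_partition_cat h1 h2.
by rewrite cat_path p1/=; case: h1 => _ /eqP ->.
Qed.

Lemma strong_eps_chain_concat e f g p q : f 1 = g 0 ->
  strong_eps_chain e f 0 1 p -> strong_eps_chain e g 0 1 q ->
  strong_eps_chain e (path_concat f g) 0 1 (p ++ q).
Proof.
move=> fg [ts tsP ->] [ss ssP ->].
have i2 : 0 < 2^-1 :> R by rewrite invr_gt0.
have hf u : 0 <= u <= 1 -> path_concat f g (2^-1 * u + 0) = f u.
  by move=> u01; rewrite /path_concat ifT; [congr f|]; lra.
have hg u : 0 <= u <= 1 -> path_concat f g (2^-1 * u + 2^-1) = g u.
  rewrite /path_concat => u01; have [->|u0] := eqVneq u 0.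
    by rewrite mulr0 add0r lexx divff.
  rewrite ifF; first by congr g; lra.
  have : 0 < u by rewrite lt_neqAle eq_sym u0; case/andP: u01.
  by move=> ?; apply/negP; lra.
have [t1 t2] := strong_partition_affine i2 hf tsP.
have [s1 s2] := strong_partition_affine i2 hg ssP.
exists ([seq 2^-1 * t + 0 | t <- ts] ++ [seq 2^-1 * t + 2^-1 | t <- ss]).
  apply: (strong_partition_cat (b := 2^-1)).
    by move: t1; rewrite mulr0 mulr1 !addr0.
  move: s1; rewrite mulr0 mulr1 add0r (_ : 2^-1 + 2^-1 = 1 :> R)//; lra.
by rewrite map_cat t2 s2.
Qed.

Lemma compact_unif_continuous {M : pseudoMetricType R} (K : set M) (F : M -> X)
    e : compact K -> {within K, continuous F} -> 0 < e ->
  exists2 d : R, 0 < d &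
    forall p q, K p -> K q -> ball p d q -> mdist (F p) (F q) < e.
Proof.
move=> /compact_near_coveringP/near_covering_withinP cK.
move=> /subspace_continuousP cF e0.
pose P (d : R) (p : M) := forall q, K q -> ball p d q -> mdist (F p) (F q) < e.
have : \forall d \near 0^'+, K `<=` P d.
  apply: cK => p Kp.
  have : nbhs (F p) (ball (F p) (e / 2)) by apply: nbhsx_ballx; rewrite divr_gt0.
  move=> /(cF _ Kp); rewrite /nbhs/= /within/= => /nbhs_ballP[r /= r0 rP].
  exists (ball p (r / 2), [set d : R | 0 < d < r / 2]).
    split => /=; first by apply: nbhsx_ballx; rewrite divr_gt0.
    near=> d; apply/andP; split; near: d; first exact: nbhs_right_gt.
    by apply: nbhs_right_lt; rewrite divr_gt0.
  move=> [p' d] /= [pp' /andP[d0 dr]] Kp' q Kq p'q.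
  have pq : ball p r q.
    rewrite (splitr r); apply: (ball_triangle pp').
    by apply: le_ball p'q; exact: ltW.
  have rr : r / 2 <= r by rewrite ler_pdivrMr// ler_pMr// ler1n.
  have {}pp' : ball p r p' by apply: le_ball pp'.
  have := rP _ pp' Kp'; have := rP _ pq Kq; rewrite /= !ballEmdist /= => h1 h2.
  rewrite (le_lt_trans (metric_triangle _ (F p) _))// (splitr e) ltrD//.
  by rewrite metric_sym.
move=> h; near (0 : R)^'+ => d; exists d => //.
have KP : K `<=` P d by near: d; exact: h.
by move=> p q /KP; exact.
Unshelve. all: by end_near. Qed.

Definition grid (n i : nat) : R := i%:R / n%:R.

Lemma grid_partition n : (0 < n)%N ->
  itv_partition 0 1 [seq grid n i | i <- iota 1 n].
Proof.
move=> n0; have E : 0 = grid n 0 :> R by rewrite /grid mul0r.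
have n0R : 0 < n%:R^-1 :> R by rewrite invr_gt0 ltr0n.
rewrite [in X in itv_partition X]E; split.
  by apply: path_map_iota => i _; rewrite /grid ltr_pM2r// ltr_nat.
by rewrite last_map_iota /grid add0n divff// pnatr_eq0 -lt0n.
Qed.

Lemma strong_eps_chain_grid e f n : (0 < n)%N ->
  (forall s t, I s -> I t -> `|s - t| <= n%:R^-1 -> mdist (f s) (f t) < e) ->
  strong_eps_chain e f 0 1 [seq f (grid n i) | i <- iota 1 n].
Proof.
move=> n0 h; exists [seq grid n i | i <- iota 1 n]; last by rewrite -map_comp.
split; first exact: grid_partition.
have E : 0 = grid n 0 :> R by rewrite /grid mul0r.
rewrite [in X in path _ X]E; apply: path_map_iota => i /andP[_].
rewrite add0n => i_n; apply/asboolP/strong_stepP => u.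
have n0R : 0 < n%:R :> R by rewrite ltr0n.
have gS : grid n i.+1 = grid n i + n%:R^-1.
  by rewrite /grid -[i.+1]addn1 natrD mulrDl mul1r.
have g0 : 0 <= grid n i by rewrite /grid divr_ge0.
have g1 : grid n i.+1 <= 1 by rewrite /grid ler_pdivrMr// mul1r ler_nat.
have nV : 0 < n%:R^-1 :> R by rewrite invr_gt0.
rewrite gS in g1 *.
move=> /andP[u1 u2]; split; apply: h; rewrite ?unit_itvE ?ler_norml; lra.
Qed.

Lemma strong_eps_chain_exists e f : 0 < e -> {within I, continuous f} ->
  exists c, strong_eps_chain e f 0 1 c.
Proof.
move=> e0 cf.
have [d d0 dP] := compact_unif_continuous (@segment_compact _ 0 1) cf e0.
have [n n0 nd] : exists2 n, (0 < n)%N & n%:R^-1 < d.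
  by have [n nd] := ltr_add_invr (y := 0) (x := d) d0; exists n.+1; rewrite // -[_^-1]add0r.
exists [seq f (grid n i) | i <- iota 1 n]; apply: strong_eps_chain_grid => //.
by move=> s t Is It st; apply: dP => //; exact: le_lt_trans st nd.
Qed.

Lemma eps_homotopic_zip e (u v : nat -> X) m n : 0 < e ->
  u (m + n)%N = v (m + n)%N ->
  (forall i, (m <= i <= m + n)%N -> mdist (u i) (v i) < e) ->
  (forall i, (m <= i < m + n)%N -> [/\ mdist (u i) (u i.+1) < e,
     mdist (v i) (v i.+1) < e & mdist (v i) (u i.+1) < e]) ->
  eps_homotopic e (u m) (u (m + n)%N) [seq u i | i <- iota m.+1 n]
    (v m :: [seq v i | i <- iota m.+1 n]).
Proof.
move=> e0; elim: n m => [|n IH] m uv d0 d1.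
  rewrite addn0 in uv *; rewrite /= -uv.
  apply: (eps_homotopic_add (p1 := [::]) (p2 := [::]));
  by rewrite /eps_chain /= ?eqxx// mdistxx e0.
have m0 : (m <= m <= m + n.+1)%N by rewrite leqnn leq_addr.
have m1 : (m <= m < m + n.+1)%N by rewrite leqnn addnS ltnS leq_addr.
have m2 : (m <= m.+1 <= m + n.+1)%N by rewrite leqnSn addnS ltnS leq_addr.
have [uu vv vu] := d1 _ m1.
have h : eps_homotopic e (u m.+1) (u (m.+1 + n)%N)
    [seq u i | i <- iota m.+2 n] (v m.+1 :: [seq v i | i <- iota m.+2 n]).
  apply: IH; rewrite addSnnS// => i /andP[mi im].
    by apply: d0; rewrite (ltnW mi).
  by apply: d1; rewrite (ltnW mi).
rewrite addSnnS in h.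
have cu1 : eps_chain e (u m) (u m.+1) [:: u m.+1].
  by rewrite /eps_chain /= uu eqxx.
apply: eps_homotopic_trans (eps_homotopic_catl cu1 h) _ => /=.
have pv : eps_chain e (v m.+1) (u (m + n.+1)%N) [seq v i | i <- iota m.+2 n].
  rewrite uv /eps_chain -addSnnS last_map_iota eqxx andbT.
  apply: path_map_iota => i /andP[mi im]; have [] // := d1 i.
  by rewrite (ltnW mi) -addSnnS.
have uv0 := d0 _ m0; have uv1 := d0 _ m2.
apply: (@eps_homotopic_trans _ _ _ _ _ (v m :: u m.+1 :: v m.+1 :: [seq v i | i <- iota m.+2 n])).
  by apply: (eps_homotopic_add (p1 := [::]));
    rewrite /= !eps_chain_cons pv ?uu ?uv0 ?vu ?uv1.
by apply: (eps_homotopic_del (p1 := [:: v m]));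
  rewrite /= !eps_chain_cons pv ?uu ?uv0 ?vu ?uv1 ?vv.
Qed.

Lemma eps_homotopic_grid e f g n : (0 < n)%N -> 0 < e -> f 0 = g 0 ->
  f 1 = g 1 ->
  (forall s t, I s -> I t -> `|s - t| <= n%:R^-1 ->
    [/\ mdist (f s) (f t) < e, mdist (g s) (g t) < e & mdist (f s) (g t) < e]) ->
  eps_homotopic e (f 0) (f 1) [seq f (grid n i) | i <- iota 1 n]
    [seq g (grid n i) | i <- iota 1 n].
Proof.
move=> n0 e0 fg0 fg1 h.
have n0R : 0 < n%:R :> R by rewrite ltr0n.
have nV : 0 < n%:R^-1 :> R by rewrite invr_gt0.
have gS i : grid n i.+1 = grid n i + n%:R^-1.
  by rewrite /grid -[i.+1]addn1 natrD mulrDl mul1r.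
have gI i : (i <= n)%N -> I (grid n i).
  by move=> i_n; rewrite unit_itvE /grid divr_ge0//= ler_pdivrMr// mul1r ler_nat.
have g00 : grid n 0 = 0 by rewrite /grid mul0r.
have g11 : grid n n = 1 by rewrite /grid divff// gt_eqF.
have step i : (i < n)%N -> `|grid n i - grid n i.+1| <= n%:R^-1.
  by move=> _; rewrite gS opprD addrA subrr add0r normrN gtr0_norm.
pose u i := f (grid n i); pose v i := g (grid n i).
have d1 i : (i < n)%N -> [/\ mdist (u i) (u i.+1) < e,
     mdist (v i) (v i.+1) < e & mdist (v i) (u i.+1) < e].
  move=> i_n; have [h1 h2 h3] := h _ _ (gI _ (ltnW i_n)) (gI _ i_n) (step _ i_n).
  split => //; rewrite metric_sym.
  have : `|grid n i.+1 - grid n i| <= n%:R^-1 by rewrite distrC step.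
  by move=> /(h _ _ (gI _ i_n) (gI _ (ltnW i_n)))[].
have := @eps_homotopic_zip e u v 0 n e0.
rewrite add0n /u /v g11 g00 => /(_ fg1) H.
apply: eps_homotopic_trans (H _ _) _.
- move=> i /= i_n; have [] // := h _ _ (gI _ i_n) (gI _ i_n).
  by rewrite subrr normr0 ltW.
- by move=> i /d1.
have c0 : eps_chain e (g 0) (g 1) [seq g (grid n i) | i <- iota 1 n].
  rewrite /eps_chain -g00 (last_map_iota v) /v add0n g11 eqxx andbT.
  by apply: (path_map_iota (g := v)) => i /d1[].
rewrite fg0 fg1; apply: (eps_homotopic_del (p1 := [::])) => //.
by rewrite /= eps_chain_cons c0 mdistxx e0.
Qed.

Lemma strong_eps_chain_homotopic e f g p q : 0 < e -> path_homotopic f g ->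
  strong_eps_chain e f 0 1 p -> strong_eps_chain e g 0 1 q ->
  eps_homotopic e (f 0) (f 1) p q.
Proof.
move=> e0 [H [cH h0 h1 he]] fp gq.
have [fg0 fg1] := homotopy_right h0 h1 he.
have cI : compact (I `*` I) by apply: compact_setX; exact: segment_compact.
have [d d0 dP] := compact_unif_continuous cI cH e0.
have [n n0 nd] : exists2 n, (0 < n)%N & n%:R^-1 < d.
  by have [n nd] := ltr_add_invr (y := 0) (x := d) d0; exists n.+1; rewrite // -[_^-1]add0r.
have nV : 0 < n%:R^-1 :> R by rewrite invr_gt0 ltr0n.
have n0R : 0 < n%:R :> R by rewrite ltr0n.
have gI i : (i <= n)%N -> I (grid n i).
  by move=> i_n; rewrite unit_itvE /grid divr_ge0//= ler_pdivrMr// mul1r ler_nat.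
have key s t s' t' : I s -> I t -> I s' -> I t' -> `|s - s'| <= n%:R^-1 ->
    `|t - t'| <= n%:R^-1 -> mdist (H (s, t)) (H (s', t')) < e.
  move=> Is It Is' It' ss' tt'; apply: dP => //.
  by split => /=; [exact: le_lt_trans ss' nd|exact: le_lt_trans tt' nd].
have n00 : `|0 : R| <= n%:R^-1 by rewrite normr0 ltW.
pose row j := [seq H (grid n i, grid n j) | i <- iota 1 n].
have rows j : (j <= n)%N -> eps_homotopic e (f 0) (f 1) (row 0%N) (row j).
  elim: j => [_|j IH j_n]; first exact: rt_refl.
  apply: eps_homotopic_trans (IH (ltnW j_n)) _.
  have [a0 a1] := he _ (gI _ (ltnW j_n)); have [b0 b1] := he _ (gI _ j_n).
  have := @eps_homotopic_grid e (fun s => H (s, grid n j))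
    (fun s => H (s, grid n j.+1)) n n0 e0.
  rewrite a0 a1 b0 b1 => /(_ erefl erefl); apply => s t Is It st.
  have jn := gI _ (ltnW j_n); have jn1 := gI _ j_n.
  split; apply: key; rewrite ?subrr//.
  rewrite /grid -mulrBl -[j.+1]addn1 natrD opprD addrA subrr add0r.
  by rewrite mulN1r normrN gtr0_norm.
have g00 : grid n 0 = 0 by rewrite /grid mul0r.
have g11 : grid n n = 1 by rewrite /grid divff// gt_eqF.
have row0 : row 0%N = [seq f (grid n i) | i <- iota 1 n].
  apply/eq_in_map => i; rewrite mem_iota add1n ltnS g00 => /andP[_ i_n].
  by rewrite h0//; exact: gI.
have row1 : row n = [seq g (grid n i) | i <- iota 1 n].
  apply/eq_in_map => i; rewrite mem_iota add1n ltnS g11 => /andP[_ i_n].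
  by rewrite h1//; exact: gI.
apply: (@eps_homotopic_trans _ _ _ _ _ (row 0%N)).
  apply: strong_eps_chain_unique fp _; rewrite row0.
  apply: strong_eps_chain_grid => // s t Is It st.
  by rewrite -!h0//; apply: key; rewrite ?subrr//; exact: unit_itv0.
apply: eps_homotopic_trans (rows n _) _ => //.
rewrite fg0 fg1; apply: strong_eps_chain_unique gq; rewrite row1.
apply: strong_eps_chain_grid => // s t Is It st.
by rewrite -!h1//; apply: key; rewrite ?subrr//; exact: unit_itv1.
Qed.

End strong_chains.

Section quotient_group.
Variable G : groupType.

Record normal_subgroup := NormalSubgroup {
  nsubg_set :> set G;
  nsubg1 : nsubg_set 1%g;
  nsubgM : forall x y, nsubg_set x -> nsubg_set y -> nsubg_set (x * y)%g;
  nsubgV : forall x, nsubg_set x -> nsubg_set x^-1%g;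
  nsubgJ : forall x y, nsubg_set x -> nsubg_set (x ^ y)%g }.

Variable N : normal_subgroup.
Implicit Types x y z : G.

Definition same_coset x y : bool := `[< nsubg_set N (x^-1 * y)%g >].

Lemma same_coset_refl : reflexive same_coset.
Proof. by move=> x; apply/asboolP; rewrite mulVg; exact: nsubg1. Qed.

Lemma same_coset_sym : symmetric same_coset.
Proof.
have h x y : nsubg_set N (x^-1 * y)%g -> nsubg_set N (y^-1 * x)%g.
  by move=> /nsubgV; rewrite invgM invgK.
by move=> x y; apply/asboolP/asboolP; exact: h.
Qed.

Lemma same_coset_trans : transitive same_coset.
Proof.
move=> y x z /asboolP xy /asboolP yz; apply/asboolP.
by have := nsubgM xy yz; rewrite mulgA mulgK.
Qed.

Canonical same_coset_equiv := EquivRel same_coset same_coset_refl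
  same_coset_sym same_coset_trans.

Definition quotient_group := {eq_quot same_coset}.
HB.instance Definition _ := Choice.on quotient_group.
HB.instance Definition _ := EqQuotient.on quotient_group.

Definition quotient_proj (x : G) : quotient_group := \pi_quotient_group x.

Lemma quotient_projP x y :
  quotient_proj x = quotient_proj y <-> nsubg_set N (x^-1 * y)%g.
Proof. by split=> [/eqmodP/asboolP//|xy]; apply/eqmodP/asboolP. Qed.

Lemma repr_quotient_proj x : nsubg_set N ((repr (quotient_proj x))^-1 * x)%g.
Proof. by apply/quotient_projP; rewrite /quotient_proj reprK. Qed.

Definition quotient_one : quotient_group := quotient_proj 1%g.
Definition quotient_mul (c d : quotient_group) : quotient_group :=
  quotient_proj (repr c * repr d)%g.
Definition quotient_inv (c : quotient_group) : quotient_group :=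
  quotient_proj (repr c)^-1%g.

Lemma quotient_mulE x y :
  quotient_mul (quotient_proj x) (quotient_proj y) = quotient_proj (x * y)%g.
Proof.
apply/quotient_projP; rewrite invgM.
set y' := repr (quotient_proj y); set x' := repr (quotient_proj x).
have -> : (y'^-1 * x'^-1 * (x * y) = (y'^-1 * y) * (x'^-1 * x) ^ y)%g.
  by rewrite /conjg !mulgA mulgK.
by apply: nsubgM; [|apply: nsubgJ]; exact: repr_quotient_proj.
Qed.

Lemma quotient_projK (c : quotient_group) : quotient_proj (repr c) = c.
Proof. by rewrite /quotient_proj reprK. Qed.

Lemma quotient_mulA : associative quotient_mul.
Proof.
move=> c d k; rewrite -(quotient_projK c) -(quotient_projK d) -(quotient_projK k).
by rewrite (quotient_mulE (repr d)) (quotient_mulE (repr c)) !quotient_mulE mulgA.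
Qed.

Lemma quotient_mul1 : left_id quotient_one quotient_mul.
Proof. by move=> c; rewrite -(quotient_projK c) quotient_mulE mul1g. Qed.

Lemma quotient_mulr1 : right_id quotient_one quotient_mul.
Proof. by move=> c; rewrite -(quotient_projK c) quotient_mulE mulg1. Qed.

Lemma quotient_mulV : left_inverse quotient_one quotient_inv quotient_mul.
Proof.
by move=> c; rewrite -{2}(quotient_projK c) quotient_mulE mulVg.
Qed.

Lemma quotient_mulrV : right_inverse quotient_one quotient_inv quotient_mul.
Proof.
by move=> c; rewrite -{1}(quotient_projK c) quotient_mulE mulgV.
Qed.

HB.instance Definition _ := isGroup.Build quotient_group quotient_mulA
  quotient_mul1 quotient_mulr1 quotient_mulV quotient_mulrV.

Lemma quotient_projM : {morph quotient_proj : x y / (x * y)%g}.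
Proof. by move=> x y; rewrite -quotient_mulE. Qed.

HB.instance Definition _ := isMultiplicative.Build G quotient_group
  quotient_proj quotient_projM.

End quotient_group.

Section kernel.
Context {R : realType} {X : metricType R}.
Variable b : X.
Implicit Types (e : R) (f g : loop b).

(* xget only picks one of the strong ε-chains along a representative of c: one
   exists when 0 < e, and by h_epsE the class does not depend on the choices. *)
Definition h_eps e (c : pi1 b) : pi_eps e b :=
  \pi_(pi_eps e b) (xget (eps_loop_one e b)
    [set p : eps_loop e b | strong_eps_chain e (repr c) 0 1 (val p)]).

Lemma strong_eps_loop_exists e f : 0 < e ->
  exists p : eps_loop e b, strong_eps_chain e f 0 1 (val p).
Proof.
move=> e0; have [c fc] := strong_eps_chain_exists e0 (@loop_continuous _ _ _ f).
have := strong_eps_chainW fc; rewrite loop_start loop_end => bc.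
by exists (Sub c bc).
Qed.

Lemma h_epsE e f (p : eps_loop e b) : 0 < e ->
  strong_eps_chain e f 0 1 (val p) -> h_eps e (\pi_(pi1 b) f) = \pi_(pi_eps e b) p.
Proof.
move=> e0 fp; rewrite /h_eps; case: xgetP => [q _ /= fq|].
  have := strong_eps_chain_homotopic e0 (repr_pi1 f) fq fp.
  by rewrite loop_start loop_end => /pi_epsP.
have [q fq] := strong_eps_loop_exists (repr (\pi_(pi1 b) f)) e0.
by move=> /(_ q).
Qed.

Lemma h_epsM e : 0 < e -> {morph h_eps e : x y / (x * y)%g}.
Proof.
move=> e0; elim/quotW => f; elim/quotW => g.
have [p fp] := strong_eps_loop_exists f e0.
have [q gq] := strong_eps_loop_exists g e0.
rewrite mul_pi1 (h_epsE e0 fp) (h_epsE e0 gq) mul_pi_eps; apply: h_epsE => //.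
rewrite loop_mulE val_eps_loop_mul; apply: strong_eps_chain_concat => //.
by rewrite loop_start loop_end.
Qed.

Definition K_eps e : set (pi1 b) := [set c | h_eps e c = 1%g].

Definition pi_cl_set : set (pi1 b) := \bigcap_(e in [set e : R | 0 < e]) K_eps e.

Lemma h_eps1 e : 0 < e -> h_eps e 1%g = 1%g.
Proof.
move=> e0; apply: (@mulgI _ (h_eps e 1%g)).
by rewrite -h_epsM// !mulg1.
Qed.

Lemma pi_cl1 : pi_cl_set 1%g.
Proof. by move=> e /= e0; exact: h_eps1. Qed.

Lemma pi_clM x y : pi_cl_set x -> pi_cl_set y -> pi_cl_set (x * y)%g.
Proof.
move=> xN yN e /= e0; rewrite /K_eps /= h_epsM//.
by rewrite (xN e e0) (yN e e0) mulg1.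
Qed.

Lemma pi_clV x : pi_cl_set x -> pi_cl_set x^-1%g.
Proof.
move=> xN e /= e0; rewrite /K_eps /=; apply: (@mulgI _ (h_eps e x)).
by rewrite -h_epsM// mulgV mulg1 (xN e e0) h_eps1.
Qed.

Lemma pi_clJ x y : pi_cl_set x -> pi_cl_set (x ^ y)%g.
Proof.
move=> xN e /= e0; rewrite /K_eps /= /conjg !h_epsM// (xN e e0) mul1g.
by rewrite -h_epsM// mulVg h_eps1.
Qed.

Definition pi_cl : normal_subgroup (pi1 b) :=
  NormalSubgroup pi_cl1 pi_clM pi_clV pi_clJ.

Definition pi1bar : groupType := quotient_group pi_cl.

Definition pi1bar_proj : pi1 b -> pi1bar := quotient_proj pi_cl.

End kernel.

Arguments K_eps {R X} b e _.
Arguments pi_cl_set {R X} b _.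
Arguments pi_cl {R X} b.
Arguments pi1bar {R X} b.
Arguments pi1bar_proj {R X} b.

Definition group_isomorphism (G H : groupType) (phi : G -> H) : Prop :=
  {morph phi : x y / (x * y)%g} /\ bijective phi.

Section geodesic.
Context {R : realType} (X : metricType R).

(* This is numfun.variation with the distance of X. *)
Definition polygonal_length (a b : R) (f : R -> X) (ts : seq R) : R :=
  let F := f \o nth b (a :: ts) in
  \sum_(0 <= i < size ts) mdist (F i) (F i.+1).

Definition curve_length (a b : R) (f : R -> X) : \bar R :=
  ereal_sup [set (polygonal_length a b f ts)%:E | ts in itv_partition a b].

Definition geodesic_space : Prop := forall x y : X, exists (a b : R) (f : R -> X),
  [/\ a <= b, {within `[a, b], continuous f}, f a = x, f b = y &
      curve_length a b f = (mdist x y)%:E].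

End geodesic.

Section dimension.
Context {R : realType} (X : metricType R).
Implicit Types U V : set (set X).

Definition open_cover U : Prop :=
  (forall A, U A -> open A) /\ \bigcup_(A in U) A = [set: X].

Definition diameter (A : set X) : \bar R :=
  ereal_sup [set (mdist p.1 p.2)%:E | p in A `*` A].

Definition lebesgue_number U (l : R) : Prop :=
  forall A : set X, (diameter A < l%:E)%E -> exists2 B, U B & A `<=` B.

Definition uniform_open_cover U : Prop :=
  open_cover U /\ exists2 l : R, 0 < l & lebesgue_number U l.

Definition refines V U : Prop := forall B, V B -> exists2 A, U A & B `<=` A.

Definition cover_order_le V (n : nat) : Prop :=
  forall x : X, ([set B | V B /\ B x] #<= `I_n)%card.

Definition uniform_dim_le (n : nat) : Prop := forall U, uniform_open_cover U ->
  exists V, [/\ uniform_open_cover V, refines V U & cover_order_le V n.+1].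

Definition uniformly_one_dimensional : Prop :=
  uniform_dim_le 1 /\ ~ uniform_dim_le 0.

(* Lebesgue covering dimension. Arbitrary open covers give the same dimension
   as finite ones, since metric spaces are paracompact. *)
Definition topological_dim_le (n : nat) : Prop := forall U, open_cover U ->
  exists V, [/\ open_cover V, refines V U & cover_order_le V n.+1].

Definition topologically_one_dimensional : Prop :=
  topological_dim_le 1 /\ ~ topological_dim_le 0.

End dimension.

(* Main.v *)
Require Import Defs.
From mathcomp Require Import all_boot all_order all_algebra.
From mathcomp Require Import boolp classical_sets reals topology normedtype.
From mathcomp Require Import generic_quotient functions cardinality ereal.
From mathcomp Require Import zify lra.
Import numFieldTopology.Exports numFieldNormedType.Exports.
Import Order.TTheory GRing.Theory Num.Theory.

(** A loop f in the intersection of the groups K_eps is contracted along a tree,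
    which is never built: it is only seen through a height function on [0, 1].

    Suppose that f is a loop in X that factors through a rooted tree, and let
    g s be the height of the point reached at time s. If g s = g t is the
    minimum of g on [s, t], then the path has come back to the same point of
    the tree, so f s = f t. Conversely, any continuous g >= 0 with
    g 0 = g 1 = 0 and this property contracts f: lower a ceiling u from 1 to 0
    and replace f s by f r, where r is the last time before s at which the
    height was at most u ([contour_null_homotopic]). Such a g is called a
    contour below, and [contour] is a quantitative form of the property that
    passes to limits.

    Contours with a small error come from the dimension. A fine uniform cover
    of order at most 2 gives a colouring of X in which, among three nearby
    points, two have the same colour ([fine_colouring]). The colours met along
    a chain thus form a walk that is changed by a basic move only up to
    insertion or deletion of backtrackings x, y, x and of repetitions, so its
    free reduction is an invariant of the eps-homotopy class
    ([eps_homotopic_foldl_visit]). The reduction is carried out by a stack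
    machine, [visit]. The stack at time s is the geodesic, in the universal
    covering tree of the nerve of the cover, from the root to the point of the
    tree over f s, and the triviality of f at that scale says that the last
    stack is reduced to the root.

    The height of the stack explodes when the cover gets finer, because f may
    have infinite length. So a stack is measured by [best], the largest sum of
    phi (d (x_i, x_(i+1))) over the subsequences x of the stack, where phi is
    so flat at 0 that phi (d (f s, f t)) <= |s - t| ([gauge_exists]). Along the
    loop these sums are bounded by the elapsed time. This bounds the
    measures uniformly and makes them equicontinuous, up to the mesh of
    the cover ([contour_level]), so an ultrafilter limit over finer and finer
    covers is an exact contour ([contour_limit]).

    The claim on compact spaces is the Lebesgue number lemma: all open covers
    of a nonempty compact space are uniform, so its two dimensions agree. *)

Set Implicit Arguments.
Unset Strict Implicit.
Unset Printing Implicit Defensive.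

Local Open Scope classical_set_scope.
Local Open Scope ring_scope.

(** * Reduction of walks by a stack *)

Section visit.
(** L colours the elements of a stack, which is listed from top to bottom. *)
Context {T E : eqType} (L : T -> E).
Implicit Types (st p q K l : seq T) (t : T).

(** One step of the free reduction of the walk of the colours. A return to the
    colour below the top pops the top and leaves the earlier element of that
    colour in place, so elements never change while they are in the stack. *)
Definition visit st t : seq T :=
  if st is x :: st1 then
    if L t == L x then st
    else if st1 is y :: _ then if L t == L y then st1 else t :: st
    else t :: st
  else [:: t].

Lemma visit_head st t : exists x st1, visit st t = x :: st1 /\ L x = L t.
Proof.
case: st => [|x [|y st]] /=; first by exists t, [::].
  by case: eqP => [->|_]; [exists x, [::]|exists t, [:: x]].
case: eqP => [->|_]; first by exists x, (y :: st).
by case: eqP => [->|_]; [exists y, st|exists t, [:: x, y & st]].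
Qed.

Lemma foldl_visit_head x st t l : L x = L t ->
  exists y st1, foldl visit (x :: st) l = y :: st1 /\ L y = L (last t l).
Proof.
elim: l x st t => [|u l IH] x st t xt; first by exists x, st.
have [y [st1 [e yu]]] := visit_head (x :: st) u.
by have := IH y st1 u yu; rewrite -e.
Qed.

(** The stacks before and after reading l branch at the lowest stack met in
    between, which is a suffix m :: K of both. What lies above it afterwards
    was pushed while reading l. *)
Lemma foldl_visit_suffix x st l : exists l1 l2 m K p q,
  [/\ l = l1 ++ l2, foldl visit (x :: st) l1 = m :: K, x :: st = p ++ m :: K,
      foldl visit (x :: st) l = q ++ m :: K & subseq (rev q) l].
Proof.
elim/last_ind: l => [|l t [l1 [l2 [m [K [p [q [-> e1 e2 e3 qc]]]]]]]].
  by exists [::], [::], x, st, [::], [::]; split.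
rewrite foldl_rcons.
have keep : subseq (rev q) (rcons (l1 ++ l2) t).
  exact: subseq_trans qc (subseq_rcons _ _).
have push : subseq (rev (t :: q)) (rcons (l1 ++ l2) t).
  by rewrite rev_cons -!cats1 cat_subseq.
have same k : visit (q ++ m :: K) t = k ++ m :: K ->
    subseq (rev k) (rcons (l1 ++ l2) t) -> exists l1' l2' m' K' p' q',
    [/\ rcons (l1 ++ l2) t = l1' ++ l2', foldl visit (x :: st) l1' = m' :: K',
      x :: st = p' ++ m' :: K', visit (q ++ m :: K) t = q' ++ m' :: K' &
      subseq (rev q') (rcons (l1 ++ l2) t)].
  by move=> ek sk; exists l1, (rcons l2 t), m, K, p, k; rewrite -rcons_cat.
rewrite e3; case: q e3 qc keep push same => [|y q] e3 qc keep push same.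
- move: same => /=; case: ifP => [_|tm]; first by move=> /(_ [::]); apply.
  case: K e1 e2 e3 => [|m1 K] e1 e2 e3; first by move=> /(_ [:: t]); apply.
  case: ifP => [tm1 _|_]; last by move=> /(_ [:: t]); apply.
  exists (rcons (l1 ++ l2) t), [::], m1, K, (rcons p m), [::].
  rewrite cats0 cat_rcons foldl_rcons e3 /= tm tm1.
  by split => //; rewrite sub0seq.
- have pop : subseq (rev q) (rcons (l1 ++ l2) t).
    apply: subseq_trans keep; rewrite rev_cons; exact: subseq_rcons.
  case: q keep push pop same {e3 qc} => [|z q] /= keep push pop same.
    case: ifP same => [_|_]; first by move=> /(_ [:: y]); apply.
    case: ifP => [_|_]; first by move=> /(_ [::]); apply.
    by move=> /(_ [:: t; y]); apply.
  case: ifP same => [_|_]; first by move=> /(_ [:: y, z & q]); apply.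
  case: ifP => [_|_]; first by move=> /(_ (z :: q)); apply.
  by move=> /(_ [:: t, y, z & q]); apply.
Qed.

(** To get down to a lower stack, the walk has to go back through the colours
    of all the elements that it pops, in the order of the stack. *)
Lemma foldl_visit_revisit x p m K l : foldl visit (x :: p ++ m :: K) l = m :: K ->
  exists2 p', subseq p' l & map L p' = map L p.
Proof.
elim: l x p => [|t l IH] x p.
  by move=> /(congr1 size) /=; rewrite size_cat /= addnS; lia.
have drop1 a : subseq a l -> subseq a (t :: l).
  by move=> /subseq_trans; apply; exact: subseq_cons.
move=> /=; case: ifP => [_ /IH[p' /drop1]|_]; first by exists p'.
case: p => [|y p] /=; first by exists [::].
case: ifP => [/eqP ty /IH[p' p'l p'p]|_ /(IH t (x :: y :: p))[p' p'l p'p]].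
  by exists (t :: p'); rewrite /= ?eqxx// p'p ty.
case: p' p'l p'p => // a p' p'l [_ p'p]; exists p' => //.
by apply: drop1; apply: subseq_trans p'l; exact: subseq_cons.
Qed.

End visit.

Section reduced.
Context {E : eqType}.
Implicit Types (s : seq E) (a b : E).

Notation lvisit := (@visit E E id).

Lemma map_foldl_visit (T : eqType) (L : T -> E) st l :
  map L (foldl (visit L) st l) = foldl lvisit (map L st) (map L l).
Proof.
elim: l st => //= t l IH st; rewrite IH; congr foldl.
case: st => //= x [|y st] /=; case: ifP => //= _.
by case: ifP.
Qed.

(** Absence of repetitions a, a and of backtrackings a, b, a. *)
Fixpoint reduced s : bool :=
  if s is a :: s1 then
    (if s1 is b :: s2 then (a != b) && (if s2 is c :: _ then a != c else true)
     else true) && reduced s1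
  else true.

Lemma reduced_visit s a : reduced s -> reduced (lvisit s a).
Proof.
case: s => //= x [|y s] /=; first by case: ifP => //= ->.
case: ifP => //= ax /and3P[/andP[xy h1] h2 h3].
by case: ifP => //= ay; rewrite ?h2 ?ax ?ay ?xy ?h1 ?h2 ?h3.
Qed.

Lemma reduced_foldl s l : reduced s -> reduced (foldl lvisit s l).
Proof. by elim: l s => //= a l IH s rs; apply/IH/reduced_visit. Qed.

(** The invariance of the free reduction under the insertion of z between two
    neighbours a and c when only two colours are involved. *)
Lemma visit_triple a s z c : reduced (a :: s) -> [|| a == z, z == c | a == c] ->
  lvisit (lvisit (a :: s) z) c = lvisit (a :: s) c.
Proof.
move=> rs; have [<-|az] := eqVneq a z.
  by rewrite /visit eqxx.
have [<- _|zc] := eqVneq z c.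
  have [y [st1 [-> <-]]] := visit_head id (a :: s) z.
  by rewrite /= eqxx.
(* The new point is a backtracking a, z, a: it is pushed and popped, or, when z
   is the colour below a, popped and pushed. *)
move=> /= /eqP ac; rewrite -{c}ac in zc *.
case: s rs => [_|b s] /=.
  by rewrite (negbTE zc) /= !eqxx (negbTE az).
move=> /and3P[/andP[ab bs] h3 _]; rewrite eqxx (negbTE zc).
have [zb|zb] := eqVneq z b; last by rewrite /= eqxx (negbTE az).
by case: s bs h3 => [|d s] /=; rewrite (negbTE ab) // => /negbTE->.
Qed.

End reduced.

Section basic_moves.
Context {R : realType} {X : metricType R} {E : eqType}.
Variables (e : R) (v : X -> E).
Hypothesis v3 : forall x y z, mdist x y < e -> mdist x z < e ->
  [|| v x == v y, v y == v z | v x == v z].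

Notation lvisit := (@visit E E id).

(** A basic move inserts or deletes a point z between neighbours that stay
    close to each other, so the three points have at most two colours. *)
Lemma eps_homotopic_foldl_visit x y p q : 0 < e -> eps_homotopic e x y p q ->
  foldl lvisit [:: v x] (map v p) = foldl lvisit [:: v x] (map v q).
Proof.
move=> e0; elim=> // {p q} [p q [cp cq h]|p q r _ -> _ ->//].
wlog: p q cp cq {h} / adds_point p q => [wl|].
  by case: h => h; [|symmetry]; exact: wl.
move=> [p1 [p2 [z [pE qE]]]]; rewrite {}pE {}qE in cp cq *.
rewrite !map_cat !foldl_cat /=.
have [a [s [eas aE]]] :=
  @foldl_visit_head _ _ id (v x) [::] (v x) (map v p1) erefl.
have rs : reduced (a :: s) by rewrite -eas; exact: reduced_foldl.
rewrite last_map /= in aE; rewrite eas {eas}.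
move: cp cq; rewrite /eps_chain !cat_path !last_cat /=.
move=> /andP[/andP[_ h1]] /eqP h2 /andP[/andP[_ /andP[h3 h4]]] /eqP h5.
case: p2 h1 h2 h4 h5 => [_ /= h2 _ h5|w p2 /= /andP[h1 _] _ /andP[h4 _] _].
  by rewrite aE h2 h5 eqxx.
by rewrite visit_triple// aE; exact: v3.
Qed.

End basic_moves.

(** * The gauge of a path *)

Section gauge.
Context {R : realType} {X : metricType R}.
Variable f : R -> X.
Notation I := (`[0, 1]%classic : set R).

Definition is_gauge (phi : R -> R) : Prop :=
  [/\ forall x y, x <= y -> phi x <= phi y <= phi x + (y - x),
      forall x, x <= 0 -> phi x = 0,
      forall x, 0 < x -> 0 < phi x &
      forall s t, I s -> I t -> phi (mdist (f s) (f t)) <= `|s - t|].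

(** The infimum over s, t of |s - t| + max 0 (x - d (f s, f t)) is 1-Lipschitz
    in x. It is positive for x > 0 because uniform continuity prevents both terms
    from being small. *)
Lemma gauge_exists : {within I, continuous f} -> exists phi, is_gauge phi.
Proof.
move=> cf.
pose w x (p : R * R) := `|p.1 - p.2| + Num.max 0 (x - mdist (f p.1) (f p.2)) : R.
have w0 x p : 0 <= w x p by rewrite addr_ge0// le_max lexx.
pose phi x := inf [set w x p | p in I `*` I].
have hi x : has_inf [set w x p | p in I `*` I].
  split; last by exists 0 => _ [p _ <-].
  by exists (w x (0, 0)); exists (0, 0) => //=; split; exact: unit_itv0.
have phi_le x s t : I s -> I t -> phi x <= w x (s, t).
  by move=> Is It; apply: ge_inf; [exact: (hi x).2|exists (s, t)].
have le_phi x (c : R) : (forall s t, I s -> I t -> c <= w x (s, t)) -> c <= phi x.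
  move=> h; apply: lb_le_inf; first exact: (hi x).1.
  by move=> _ [[s t] [Is It] <-]; exact: h.
have wmax (x y s t : R) : x <= y ->
    w x (s, t) <= w y (s, t) <= w x (s, t) + (y - x).
  move=> xy; rewrite /w /=; set m := mdist _ _; rewrite !maxEle.
  by case: (leP 0 (x - m)); case: (leP 0 (y - m)) => ? ?; lra.
exists phi; split.
- move=> x y xy; apply/andP; split.
    apply: le_phi => s t Is It; apply: le_trans (phi_le _ _ _ Is It) _.
    by have /andP[] := wmax _ _ s t xy.
  rewrite -lerBlDr; apply: le_phi => s t Is It; rewrite lerBlDr.
  by apply: le_trans (phi_le _ _ _ Is It) _; have /andP[] := wmax _ _ s t xy.
- move=> x x0; apply/eqP; rewrite eq_le; apply/andP; split.
    have I0 : I 0 by exact: unit_itv0.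
    apply: le_trans (phi_le _ 0 0 I0 I0) _.
    by rewrite /w /= subrr normr0 mdistxx add0r subr0 ge_max lexx x0.
  by apply: le_phi => s t Is It; exact: w0.
- move=> x x0.
  have x20 : 0 < x / 2 by rewrite divr_gt0.
  have [d d0 dP] := compact_unif_continuous (@segment_compact _ 0 1) cf x20.
  apply: (@lt_le_trans _ _ (Num.min d (x / 2))).
    by rewrite lt_min d0.
  apply: le_phi => s t Is It; rewrite /w /= ge_min.
  case: (leP d `|s - t|) => [dst|std]; apply/orP; [left|right].
    by rewrite (le_trans dst)// lerDl le_max lexx.
  have /ltW h := dP _ _ Is It std.
  by rewrite -[x / 2]add0r lerD// le_max; apply/orP; right; lra.
- move=> s t Is It; apply: le_trans (phi_le _ _ _ Is It) _.
  by rewrite /w /= subrr maxxx addr0.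
Qed.

Section gauge_theory.
Variable phi : R -> R.
Hypothesis gphi : is_gauge phi.

Lemma gauge_le x y : x <= y -> phi x <= phi y.
Proof. by have [h _ _ _] := gphi => /h/andP[]. Qed.

Lemma gauge_le0 x : x <= 0 -> phi x = 0.
Proof. by have [_ h _ _] := gphi; exact: h. Qed.

Lemma gauge_gt0 x : 0 < x -> 0 < phi x.
Proof. by have [_ _ h _] := gphi; exact: h. Qed.

Lemma gauge_ge0 x : 0 <= phi x.
Proof. by case: (leP x 0) => [/gauge_le0->|/gauge_gt0/ltW]. Qed.

Lemma gauge_lipschitz x y c : y <= x + c -> 0 <= c -> phi y <= phi x + c.
Proof.
have [h _ _ _] := gphi => yx c0; case: (leP x y) => xy.
  by have /andP[_ /le_trans] := h _ _ xy; apply; lra.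
by apply: le_trans (gauge_le (ltW xy)) _; lra.
Qed.

End gauge_theory.

End gauge.

(** * The measure of a stack *)

Section best.
Context {R : realType} {T : eqType} (w : T -> T -> R).
Implicit Types (x y z m : T) (p K : seq T).

(** The largest sum of the weights w of consecutive elements over the
    subsequences of x :: p that start with x. *)
Fixpoint best x p : R :=
  if p is y :: q then Num.max (w x y + best y q) (best x q) else 0.

Lemma best_ge0 x p : 0 <= best x p.
Proof. by elim: p x => //= y p IH x; rewrite le_max IH orbT. Qed.

Lemma best_suffix x p m K : w x m + best m K <= best x (p ++ m :: K).
Proof.
by elim: p => [|y p IH] /=; rewrite le_max ?lexx// IH orbT.
Qed.

Lemma best_lipschitz x m K c : (forall y, w x y <= w m y + c) -> 0 <= c ->
  best x K <= best m K + c.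
Proof.
move=> h c0; elim: K => [|y K IH] /=; first by rewrite add0r.
rewrite ge_max; apply/andP; split.
  rewrite -lerBlDr le_max; apply/orP; left.
  by rewrite lerBlDr -addrAC lerD2r.
by apply: le_trans IH _; rewrite lerD2r le_max lexx orbT.
Qed.

(** A pair (x, t) is an element x marked with a time t. If the weights are
    dominated by the differences of the marks, then the part of a sum above K
    telescopes. *)
Lemma best_cat_le (a : T * R) (p : seq (T * R)) K (e B : R) :
  pairwise (fun a b => w a.1 b.1 <= b.2 - a.2) (a :: p) ->
  {in a :: p, forall b, b.2 <= e /\ best b.1 K <= B} ->
  best a.1 (map fst p ++ K) <= B + (e - a.2).
Proof.
elim: p a => [|b p IH] a /= h1 h2.
  have [h3 h4] := h2 a (mem_head _ _).
  by rewrite -[leLHS]addr0 lerD// subr_ge0.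
move: h1 => /andP[/andP[ab ap] /andP[bp pp]].
rewrite ge_max; apply/andP; split.
  have -> : B + (e - a.2) = (b.2 - a.2) + (B + (e - b.2)) by lra.
  apply: lerD => //; apply: IH => /=; first by rewrite bp.
  by move=> c cp; apply: h2; rewrite inE cp orbT.
apply: IH => /=; first by rewrite ap.
move=> c; rewrite inE => /orP[/eqP->|cp]; apply: h2; rewrite !inE ?eqxx//.
by rewrite cp !orbT.
Qed.

End best.

Section filter_le.
Context {R : realType}.
Implicit Types (s t : R) (ts : seq R).

Lemma filter_le_nil s t ts :
  path <%R t ts -> s <= t -> [seq u <- ts | u <= s] = [::].
Proof.
move=> /(order_path_min lt_trans)/allP h st; rewrite -(filter_pred0 ts).
by apply: eq_in_filter => u /h tu; rewrite leNgt (le_lt_trans st tu).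
Qed.

Lemma filter_le_cat s t ts : sorted <%R ts -> s <= t ->
  [seq u <- ts | u <= t] =
  [seq u <- ts | u <= s] ++ [seq u <- ts | s < u <= t].
Proof.
move=> + st; elim: ts => //= u ts IH uts.
have {}IH := IH (path_sorted uts).
case: (leP u s) => [us|su]; first by rewrite (le_trans us st) /= IH.
have E := filter_le_nil uts (ltW su).
by case: ifP => _; rewrite IH E.
Qed.

Lemma filter_le_last s t ts l1 l2 : sorted <%R ts ->
  [seq u <- ts | s < u <= t] = l1 ++ l2 ->
  [seq u <- ts | u <= last s l1] = [seq u <- ts | u <= s] ++ l1.
Proof.
move=> sts l12.
have sl : sorted <%R (l1 ++ l2).
  by rewrite -l12; apply: sorted_filter => //; exact: lt_trans.
have inl u : u \in l1 ++ l2 -> s < u <= t.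
  by rewrite -l12 mem_filter => /andP[].
case/lastP: l1 => [|l1 r] in l12 sl inl *; first by rewrite cats0.
rewrite last_rcons.
have /andP[sr rt] : s < r <= t by apply: inl; rewrite mem_cat mem_rcons mem_head.
rewrite (filter_le_cat sts (ltW sr)); congr (_ ++ _).
have -> : [seq u <- ts | s < u <= r] = [seq u <- rcons l1 r ++ l2 | u <= r].
  rewrite -l12 -filter_predI; apply: eq_filter => u /=.
  case: (leP u r) => ur; last by rewrite andbF.
  by rewrite (le_trans ur rt) andbT.
rewrite cat_rcons filter_cat /= lexx (@filter_le_nil r r l2)//; last first.
  by move: sl; rewrite cat_rcons sorted_cat_cons => /andP[].
rewrite cats1; congr rcons; apply/all_filterP/allP => u ul.
move: sl; rewrite (sorted_pairwise lt_trans) cat_rcons pairwise_cat.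
by move=> /andP[/allrelP h _]; rewrite ltW// h// mem_head.
Qed.

Lemma pairwise_gt_subseq_rev (q l : seq R) : sorted <%R l -> subseq (rev q) l ->
  pairwise >%R q.
Proof.
move=> sl ql; have : sorted <%R (rev q) := subseq_sorted lt_trans ql sl.
by rewrite rev_sorted sorted_pairwise// => a b c ab bc; exact: lt_trans bc ab.
Qed.

End filter_le.

(** * Contours with an error *)

Lemma zip_map_eq (T E : eqType) (L : T -> E) p p' b :
  map L p' = map L p -> b \in zip p p' -> L b.1 = L b.2.
Proof.
elim: p p' => [|x p IH] [|x' p'] //= [xx pp]; rewrite inE => /orP[/eqP->//|].
exact: IH.
Qed.

Section contour.
Context {R : realType} {X : metricType R}.
Variables (f : R -> X) (phi : R -> R).
Notation I := (`[0, 1]%classic : set R).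

(** The last condition is the discrete form, with an error e, of the property
    of heights in a tree: if g s = g t is the minimum of g on [s, t] and e = 0,
    then phi vanishes at the distances from f s and f t to f r, so
    f s = f r = f t. In a tree, r is the time at which the path from s to t
    visits the branch point of the geodesics from the root to its ends. The
    condition before it is equicontinuity, also up to e, in a form that only
    depends on f. *)
Definition contour (e : R) (g : R -> R) : Prop :=
  [/\ forall s : R, 0 <= s <= 1 -> 0 <= g s <= 1,
      g 0 = 0, g 1 = 0,
      forall s t D : R, 0 <= s -> s <= t -> t <= 1 ->
        (forall u v : R, s <= u <= t -> s <= v <= t -> mdist (f u) (f v) <= D) ->
        `|g s - g t| <= D + (t - s) + e &
      forall s t : R, 0 <= s -> s <= t -> t <= 1 -> exists r, [/\ s <= r <= t,
        phi (mdist (f s) (f r)) <= g s - g r + e &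
        phi (mdist (f t) (f r)) <= g t - g r + e]].

Lemma filter_le_dist (e a b : R) ts s : 0 < e -> strong_partition e f a b ts ->
  a <= s <= b -> mdist (f (last a [seq u <- ts | u <= s])) (f s) < e.
Proof.
move=> e0; elim: ts a => [|t ts IH] a.
  move=> /strong_partition_nil <- /= as_.
  by rewrite (_ : s = a) ?mdistxx//; apply/eqP; rewrite eq_le andbC.
move=> /strong_partition_cons[at_ /strong_stepP st p] /andP[as_ sb] /=.
case: (leP t s) => [ts_|st_] /=; first by apply: (IH _ p); rewrite ts_.
have [[pts _] _] := p; rewrite (filter_le_nil pts (ltW st_)) /=.
by have [] := st s; rewrite ?as_ ?ltW.
Qed.

(** In this section L is the colouring at scale e, read at the times of a strong
    chain along f, and S s is the stack at time s. The weight w is corrected by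
    4 * e so that it can be bounded by differences of times even when an element
    of a stack is traded for another time of the same colour. *)
Section level.
Variables (E : eqType) (v : X -> E) (e : R) (ts : seq R).
Hypotheses (gphi : is_gauge f phi) (e0 : 0 < e)
  (v_dist : forall x y, v x = v y -> mdist x y < e)
  (tsP : strong_partition e f 0 1 ts)
  (v_end : foldl (@visit E E id) [:: v (f 0)] (map (v \o f) ts) = [:: v (f 0)]).

Let L := v \o f.
Let S s := foldl (visit L) [:: 0] [seq t <- ts | t <= s].
Let w x y := phi (mdist (f x) (f y) - 4 * e).
Let W (st : seq R) := best w (head 0 st) (behead st).
Let g s := W (S s).
(* Holds when f t is at distance less than e from a point of the colour of x. *)
Let near x t := mdist (f x) (f t) <= 2 * e.

Let w0 x y : 0 <= w x y. Proof. exact: gauge_ge0 gphi _. Qed.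

Let wxx x : w x x = 0.
Proof.
rewrite /w mdistxx sub0r (gauge_le0 gphi)// oppr_le0.
by rewrite mulr_ge0// ltW.
Qed.

Let w_near (x y s t : R) : I s -> I t -> s <= t -> near x s -> near y t ->
  w x y <= t - s.
Proof.
have [_ _ _ h] := gphi; move=> Is It st xs yt.
apply: le_trans (_ : phi (mdist (f s) (f t)) <= _); last first.
  by apply: le_trans (h _ _ Is It) _; rewrite distrC ger0_norm// subr_ge0.
apply: (gauge_le gphi); rewrite lerBlDr.
have := metric_triangle (f x) (f s) (f y).
have := metric_triangle (f s) (f t) (f y).
by move: xs yt; rewrite /near [mdist (f t) (f y)]metric_sym; lra.
Qed.

Let same_near x y t : L x = L y -> mdist (f y) (f t) < e -> near x t.
Proof.
rewrite /near => /v_dist xy yt; have := metric_triangle (f x) (f y) (f t).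
by lra.
Qed.

Let nearxx x : near x x.
Proof. by rewrite /near mdistxx mulr_ge0// ltW. Qed.

Let ts_sorted : path <%R 0 ts. Proof. by have [[]] := tsP. Qed.

Let S_cons (s : R) : 0 <= s <= 1 -> exists x st, S s = x :: st /\ near x s.
Proof.
move=> s01; have [x [st [Ss xE]]] :=
  @foldl_visit_head R E L 0 [::] 0 [seq u <- ts | u <= s] erefl.
exists x, st; split; first exact: Ss.
by apply: same_near xE _; exact: filter_le_dist tsP _.
Qed.

Let W_suffix p m K : W (m :: K) + w (head m p) m <= W (p ++ m :: K).
Proof.
case: p => [|x p] /=; first by rewrite wxx addr0.
by rewrite addrC; exact: best_suffix.
Qed.

Let best_near x m K D : mdist (f x) (f m) <= D ->
  best w x (m :: K) <= W (m :: K) + D.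
Proof.
move=> xm; have D0 : 0 <= D by exact: le_trans (mdist_ge0 _ _) xm.
rewrite /= ge_max; apply/andP; split.
  rewrite addrC lerD2l -[D]add0r -{1}(gauge_le0 gphi (lexx 0)).
  apply: (gauge_lipschitz gphi) => //.
  by rewrite add0r; have := mulr_ge0 (ler0n R 4) (ltW e0); lra.
apply: best_lipschitz => // y; apply: (gauge_lipschitz gphi) => //.
by have := metric_triangle (f x) (f m) (f y); lra.
Qed.

(** The part p of an old stack that has been popped: its elements, the first
    components, were pushed at unrelated earlier times, but the second
    components are the times at which their colours were met again, on the way
    down. *)
Let best_old (a : R * R) p K (t B : R) : t <= 1 ->
  (forall b : R * R, b \in a :: p ->
     [/\ near b.1 b.2, 0 <= b.2 <= t & best w b.1 K <= B]) ->
  pairwise (fun a b => a.2 <= b.2) (a :: p) ->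
  best w a.1 (map fst p ++ K) <= B + (t - a.2).
Proof.
move=> t1 h pp; have inI b : b \in a :: p -> I b.2.
  by move=> /h[_ /andP[b0 bt] _]; rewrite unit_itvE b0 (le_trans bt).
apply: best_cat_le; last by move=> b /h[_ /andP[]].
apply: (sub_in_pairwise (P := mem (a :: p))) pp; last by apply/allP.
move=> b c bp cp bc; have [nb _ _] := h _ bp; have [nc _ _] := h _ cp.
by apply: w_near nb nc; [exact: inI|exact: inI|exact: bc].
Qed.

(** The part q that has been pushed: its elements are themselves recent times.
    They decrease from top to bottom, hence the marks - y. *)
Let best_new z q K (s B : R) : 0 <= s ->
  (forall y : R, y \in z :: q -> s <= y <= 1 /\ best w y K <= B) ->
  pairwise >%R (z :: q) ->
  best w z (q ++ K) <= B + (z - s).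
Proof.
move=> s0 h pq; have inI y : y \in z :: q -> I y.
  by move=> /h[/andP[sy y1] _]; rewrite unit_itvE y1 (le_trans s0).
have -> : z - s = - s - - z by rewrite opprK addrC.
have -> : q = map fst (map (fun y : R => (y, - y)) q) by rewrite -map_comp map_id.
apply: (@best_cat_le _ _ _ (z, - z)); last first.
  by move=> b /(mapP (s := z :: q))[y /h[/andP[sy _] yB] ->]; rewrite lerN2.
rewrite -(map_cons (fun y : R => (y, - y))) pairwise_map.
apply: (sub_in_pairwise (P := mem (z :: q))) pq; last by apply/allP.
move=> a b aq bq ba; rewrite /= opprK addrC.
rewrite /w metric_sym; apply: w_near (nearxx _) (nearxx _);
  [exact: inI|exact: inI|exact: ltW].
Qed.

(** The stacks at times s and t branch at the stack m :: K of a time r between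
    them. Going from m :: K to the whole stack costs at least the weight of the
    jump between the tops, and at most the diameter of f on [s, t] plus the
    elapsed time, up to multiples of e. *)
Let branch (s t : R) : 0 <= s -> s <= t -> t <= 1 ->
  exists r, [/\ s <= r <= t,
    g r <= g s /\ phi (mdist (f s) (f r)) <= g s - g r + 8 * e,
    g r <= g t /\ phi (mdist (f t) (f r)) <= g t - g r + 8 * e &
    forall D,
      (forall u v : R, s <= u <= t -> s <= v <= t -> mdist (f u) (f v) <= D) ->
      g s <= g r + (D + 4 * e) + (t - s) /\ g t <= g r + (D + 4 * e) + (t - s)].
Proof.
move=> s0 st t1.
have s01 : 0 <= s <= 1 by rewrite s0 (le_trans st).
have t01 : 0 <= t <= 1 by rewrite t1 (le_trans s0).
have [x [sx [Ss xs]]] := S_cons s01.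
have sts := path_sorted ts_sorted.
have St' : S t = foldl (visit L) (x :: sx) [seq u <- ts | s < u <= t].
  by rewrite /S (filter_le_cat sts st) foldl_cat -Ss.
have [l1 [l2 [m [K [p [q [El e1 e2 e3 e4]]]]]]] :=
  foldl_visit_suffix L x sx [seq u <- ts | s < u <= t].
set r := last s l1.
have inl u : u \in l1 -> s < u <= t.
  move=> ul; have : u \in l1 ++ l2 by rewrite mem_cat ul.
  by rewrite -El mem_filter => /andP[].
have srt : s <= r <= t.
  have : r \in s :: l1 by exact: mem_last.
  by rewrite inE => /orP[/eqP->|/inl/andP[/ltW-> ->//]]; rewrite lexx.
have r01 : 0 <= r <= 1.
  by case/andP: srt => sr rt; rewrite (le_trans s0 sr) (le_trans rt t1).
have Sr : S r = m :: K by rewrite /S (filter_le_last sts El) foldl_cat -/(S s) Ss.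
have mr : near m r by have [m' [K' [+ m'r]]] := S_cons r01; rewrite Sr => -[-> _].
have gr : g r = W (m :: K) by rewrite /g Sr.
have gs : g s = W (p ++ m :: K) by rewrite /g Ss e2.
have gt : g t = W (q ++ m :: K) by rewrite /g St' e3.
have low (u : R) k : 0 <= u <= 1 -> S u = k ++ m :: K ->
    W (m :: K) <= W (k ++ m :: K) /\
    phi (mdist (f u) (f r)) <= W (k ++ m :: K) - W (m :: K) + 8 * e.
  move=> u01 Su; have := W_suffix k m K; have := w0 (head m k) m.
  have ku : near (head m k) u.
    have [z [sz [+ zu]]] := S_cons u01; rewrite Su.
    by case: k {Su} => [|z' k] /= [-> _].
  move=> h1 h2; split; first by lra.
  apply: (@le_trans _ _ (w (head m k) m + 8 * e)); last by lra.
  apply: (gauge_lipschitz gphi); last by rewrite mulr_ge0// ltW.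
  have := metric_triangle (f u) (f (head m k)) (f r).
  have := metric_triangle (f (head m k)) (f m) (f r).
  by move: ku mr; rewrite /near [mdist (f u) (f (head m k))]metric_sym; lra.
exists r; rewrite gs gt gr; split=> // [||D fD].
- exact: low s01 (etrans Ss e2).
- exact: low t01 (etrans St' e3).
have c0 : 0 <= D + 4 * e + (t - s).
  rewrite addr_ge0 ?subr_ge0// addr_ge0//; last by rewrite mulr_ge0// ltW.
  by apply: le_trans (fD s s _ _); rewrite ?mdist_ge0 ?lexx.
have bD y u : near y u -> s <= u <= t ->
    best w y (m :: K) <= W (m :: K) + (D + 4 * e).
  move=> yu /fD/(_ srt) ur; apply: best_near.
  have := metric_triangle (f y) (f u) (f m).
  have := metric_triangle (f u) (f r) (f m).
  by move: yu mr; rewrite /near [mdist (f r) _]metric_sym; lra.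
split.
- case: p e2 {gs} => [|x' p] e2; first by rewrite cat0s -addrA lerDl.
  have [xE pE] : x' = x /\ sx = p ++ m :: K by case: e2.
  rewrite {x'}xE pE in e1 e2 *.
  have [p' p'l p'p] := foldl_visit_revisit e1.
  have szp : size p = size p' by rewrite -(size_map L) -p'p size_map.
  have zip1 : map fst (zip p p') = p by apply: unzip1_zip; rewrite szp.
  have zip2 : map snd (zip p p') = p' by apply: unzip2_zip; rewrite szp.
  have marked b : b \in (x, s) :: zip p p' -> near b.1 b.2 /\ s <= b.2 <= t.
    rewrite inE => /orP[/eqP->/=|bz]; first by rewrite lexx st.
    split; first by apply: same_near (zip_map_eq p'p bz) _; rewrite mdistxx.
    have /inl/andP[/ltW-> ->//] : b.2 \in l1.
    by apply: (mem_subseq p'l); rewrite -zip2 map_f.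
  rewrite -[in leLHS]zip1; apply: (@best_old (x, s)) => //.
    move=> b /marked[bn b01]; split=> //; last exact: bD bn b01.
    by case/andP: b01 => sb ->; rewrite (le_trans s0 sb).
  rewrite -(pairwise_map snd <=%R) /= zip2; apply/andP; split.
    by apply/allP => u /(mem_subseq p'l)/inl/andP[/ltW].
  have : sorted <%R (l1 ++ l2).
    by rewrite -El; apply: sorted_filter => //; exact: lt_trans.
  rewrite (sorted_pairwise lt_trans) pairwise_cat => /and3P[_ sl1 _].
  by apply: (sub_pairwise _ (subseq_pairwise p'l sl1)) => a b; exact: ltW.
- case: q e3 e4 {gt} => [|z q] e3 e4; first by rewrite cat0s -addrA lerDl.
  have inq b : b \in z :: q -> s < b <= t.
    by rewrite -mem_rev => /(mem_subseq e4); rewrite mem_filter => /andP[].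
  have /andP[_ zt] := inq _ (mem_head _ _).
  apply: le_trans (best_new s0 (B := W (m :: K) + (D + 4 * e)) _ _) _.
  + move=> b /inq/andP[/ltW sb bt]; rewrite sb (le_trans bt t1); split => //.
    by apply: bD (nearxx b) _; rewrite sb.
  + apply: pairwise_gt_subseq_rev e4.
    by apply: sorted_filter => //; exact: lt_trans.
  + by rewrite lerD2l lerD2r.
Qed.

(** The measure of the stack is 0 at time 1 because the walk of the colours
    reduces to its origin, which is what the triviality of f at this scale gives
    through v_end. The upper bound by 1 is the length of [0, 1]: all the
    elements of a stack are times listed in decreasing order. *)
Lemma contour_level : contour (8 * e) g.
Proof.
have S0 : S 0 = [:: 0] by rewrite /S (filter_le_nil ts_sorted).
have tsI u : u \in ts -> 0 < u <= 1.
  have [[pts /eqP <-] _] := tsP.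
  move=> uts; have /allP -> //= := order_path_min (@lt_trans _ _) ts_sorted.
  case/splitPr: uts pts => l1 l2; rewrite cat_path last_cat /= => /and3P[_ _ pu].
  have := mem_last u l2; rewrite inE => /orP[/eqP->//|].
  by have /allP h := order_path_min (@lt_trans _ _) pu; move=> /h/ltW.
have g0 : g 0 = 0 by rewrite /g S0.
split=> //.
- move=> s s01; rewrite best_ge0/=.
  have [l1 [l2 [m [K [p [q [El e1 e2 e3 e4]]]]]]] :=
    foldl_visit_suffix L 0 [::] [seq u <- ts | u <= s].
  have {e2}[mE KE] : m = 0 /\ K = [::] by case: p e2 => [[]//|a []].
  rewrite /g /S e3 mE KE {e1}.
  case: q e3 e4 => [|z q] _ qs /=; first exact: ler01.
  have qts : {subset rcons (z :: q) 0 <= 0 :: ts}.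
    move=> u; rewrite mem_rcons !inE => /orP[->//|uq]; apply/orP; right.
    have : u \in rev (z :: q) by rewrite mem_rev inE.
    by move=> /(mem_subseq qs); rewrite mem_filter => /andP[].
  have qI u : u \in z :: q ++ [:: 0] -> 0 <= u <= 1.
    rewrite cats1 -rcons_cons => /qts; rewrite inE.
    move=> /orP[/eqP->|/tsI/andP[/ltW->//]].
    by rewrite lexx ler01.
  rewrite -[q ++ _]cats0; apply: le_trans (best_new (lexx 0) (B := 0) _ _) _.
  + by move=> y /qI.
  + rewrite -cat_cons cats1 pairwise_rcons; apply/andP; split.
      apply/allP => u uq.
      have : u \in rev (z :: q) by rewrite mem_rev.
      by move=> /(mem_subseq qs); rewrite mem_filter => /andP[_ /tsI/andP[]].
    apply: pairwise_gt_subseq_rev qs.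
    by apply: sorted_filter; [exact: lt_trans|exact: path_sorted ts_sorted].
  + by rewrite subr0 add0r; have /andP[] := qI z (mem_head _ _).
- rewrite /g /S (_ : [seq _ <- ts | _] = ts); last first.
    by apply/all_filterP/allP => u /tsI/andP[].
  have := congr1 size (map_foldl_visit L [:: 0] ts).
  rewrite size_map /= /L map_comp -map_comp v_end /=.
  by case: foldl => [//|z []].
- move=> s t D s0 st t1 fD.
  have [r [_ [h1 _] [h2 _] /(_ _ fD)[h3 h4]]] := branch s0 st t1.
  by rewrite ler_norml; apply/andP; split; move: (ltW e0); lra.
- move=> s t s0 st t1.
  by have [r [srt [_ h1] [_ h2] _]] := branch s0 st t1; exists r.
Qed.

End level.
End contour.

(** * Colourings of spaces of uniform dimension at most one *)

Lemma card_le_I2 (T : Type) (A : set T) (x y z : T) : (A #<= `I_2)%card ->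
  A x -> A y -> A z -> [\/ x = y, y = z | x = z].
Proof.
move=> /pcard_leP[h] Ax Ay Az.
have I2 u : A u -> (h u < 2)%N by move=> Au; exact: (@funS _ _ A `I_2 h u Au).
have inj u t : A u -> A t -> h u = h t -> u = t.
  by move=> Au At; apply: (@inj _ _ A h); rewrite inE.
have [hxy|hyz|hxz] : [\/ h x = h y, h y = h z | h x = h z].
  move: (I2 x Ax) (I2 y Ay) (I2 z Az).
  case: (h x) => [|[|//]]; case: (h y) => [|[|//]]; case: (h z) => [|[|//]] _ _ _;
    by [constructor 1|constructor 2|constructor 3].
- by constructor 1; exact: inj.
- by constructor 2; exact: inj.
- by constructor 3; exact: inj.
Qed.

Section cover.
Local Open Scope quotient_scope.
Context {R : realType} (X : metricType R).

Lemma diameter_lt (A : set X) (l : R) x y : (diameter A < l%:E)%E -> A x -> A y ->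
  mdist x y < l.
Proof.
move=> Al Ax Ay; rewrite -lte_fin; apply: le_lt_trans Al.
by apply: ereal_sup_ubound; exists (x, y).
Qed.

Lemma le_diameter (A : set X) (l : R) :
  (forall x y, A x -> A y -> mdist x y <= l) ->
  (diameter A <= l%:E)%E.
Proof.
move=> h; apply: ge_ereal_sup => _ [[x y] [/= Ax Ay] <-].
by rewrite lee_fin; exact: h.
Qed.

Lemma metric_ball_open (x : X) (e : R) : open (ball x e).
Proof.
rewrite openE => y; rewrite ballEmdist /= => xy; apply/nbhs_ballP.
exists (e - mdist x y); first by rewrite /= subr_gt0.
move=> z; rewrite !ballEmdist /= => yz.
by have := metric_triangle x y z; lra.
Qed.

Lemma uniform_balls (b : X) (e : R) : 0 < e ->
  uniform_open_cover [set A | exists x : X, A = ball x e].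
Proof.
move=> e0; split; first split.
- by move=> _ [x ->]; exact: metric_ball_open.
- apply/seteqP; split=> // x _; exists (ball x e); first by exists x.
  exact: ballxx.
exists e => // A Ae; have [->|/set0P[x Ax]] := eqVneq A set0.
  by exists (ball b e); [exists b|move=> ?].
exists (ball x e); first by exists x.
by move=> y Ay; rewrite ballEmdist /=; exact: diameter_lt Ae Ax Ay.
Qed.

(** Each point x gets as its colour a set of a fine cover V that contains a whole
    ball around x. Three close points then have colours that all contain the
    first point, and the order of V leaves at most two sets for them. *)
Lemma fine_colouring (b : X) (e : R) : uniform_dim_le X 1 -> 0 < e ->
  exists (v : X -> set X) (d : R), [/\ 0 < d <= e,
    forall x y, v x = v y -> mdist x y < e &
    forall x y z, mdist x y < d -> mdist x z < d ->
      [\/ v x = v y, v y = v z | v x = v z]].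
Proof.
move=> X1 e0; have e20 : 0 < e / 2 by rewrite divr_gt0.
have [V [[[Vo Vc] [l l0 Vl]] VU V2]] := X1 _ (uniform_balls b e20).
have l3 : 0 < l / 3 by rewrite divr_gt0.
have /choice[v vP] x : exists B, V B /\ ball x (l / 3) `<=` B.
  have [|B VB xB] := Vl (ball x (l / 3)); last by exists B.
  apply: (@le_lt_trans _ _ (2 * (l / 3))%:E); last by rewrite lte_fin; lra.
  apply: le_diameter => y z; rewrite !ballEmdist /= => xy xz.
  by have := metric_triangle y x z; rewrite [mdist y x]metric_sym; lra.
exists v, (Num.min e (l / 3)); split.
- by rewrite lt_min e0 l3 ge_min lexx.
- move=> x y vxy; have [vx xv] := vP x; have [_ yv] := vP y.
  have [_ [c ->] vc] := VU _ vx.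
  have := vc _ (xv _ (ballxx _ l3)); have : v x y by rewrite vxy; apply/yv/ballxx.
  move=> /vc; rewrite !ballEmdist /= => cy cx.
  by have := metric_triangle x c y; rewrite [mdist x c]metric_sym; lra.
- move=> x y z; rewrite !lt_min => /andP[_ xy] /andP[_ xz].
  apply: (card_le_I2 (V2 x)).
  + by split; [exact: (vP x).1|exact: (vP x).2 _ (ballxx _ l3)].
  + by split; [exact: (vP y).1|apply: (vP y).2; rewrite ballEmdist /= metric_sym].
  + by split; [exact: (vP z).1|apply: (vP z).2; rewrite ballEmdist /= metric_sym].
Qed.

Lemma contour_exists (b : X) (f : loop b) phi (e : R) : uniform_dim_le X 1 ->
  (forall d : R, 0 < d -> h_eps d (\pi_(pi1 b) f) = 1%g) -> is_gauge f phi ->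
  0 < e -> exists g, contour f phi e g.
Proof.
move=> X1 f1 gphi e0; have e80 : 0 < e / 8 by rewrite divr_gt0.
have [v [d [/andP[d0 de] vd v3]]] := fine_colouring b X1 e80.
have [p fp] := strong_eps_loop_exists f d0.
have : \pi_(pi_eps d b) p = \pi_(pi_eps d b) (eps_loop_one d b).
  by rewrite -(h_epsE d0 fp) f1.
move=> /pi_epsP; rewrite val_eps_loop_one => p1.
have [ts tsP pE] := fp.
have {}tsP : strong_partition (e / 8) f 0 1 ts.
  case: tsP => h1 h2; split => //; apply: sub_path h2 => s t /asboolP st.
  apply/asboolP; apply: subset_trans st _.
  by apply: setISS; exact: le_ball.
have -> : e = 8 * (e / 8) by lra.
eexists; apply: (contour_level gphi e80 vd tsP).
have := @eps_homotopic_foldl_visit _ _ _ d v _ b b _ _ d0 p1.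
rewrite pE -map_comp /= loop_start; apply => x y z xy xz.
by case: (v3 _ _ _ xy xz) => ->; rewrite eqxx ?orbT.
Qed.

End cover.

(** * Limits of contours *)

(** A cluster point is a limit along an ultrafilter, because every set or its
    complement is large. *)
Lemma ultrafilter_limit (R : realType) (T : Type) (U : set_system T)
    (a : T -> R) : UltraFilter U -> (forall x, 0 <= a x <= 1) ->
  exists2 p, 0 <= p <= 1 & forall e, 0 < e -> U [set x | `|a x - p| < e].
Proof.
move=> uU a01; have pU : ProperFilter (a @ U) by exact: fmap_proper_filter.
have UI : (a @ U) `[0, 1]%classic.
  apply: (@filterS _ U _ setT) => [x _ /=|]; last exact: filterT.
  by rewrite in_itv /=; exact: a01.
have [p []] := @segment_compact R 0 1 _ pU UI.
rewrite /= in_itv /= => p01 clp; exists p => // e e0.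
have [//|Un] := in_ultra_setVsetC [set x | `|a x - p| < e] uU.
have h : (a @ U) [set y | ~ `|y - p| < e] by [].
have [y [/= yn]] := clp _ _ h (nbhsx_ballx p e e0).
by rewrite /ball /= distrC => /yn.
Qed.

Section limit.
Context {R : realType} {X : metricType R}.
Variable f : R -> X.
Notation I := (`[0, 1]%classic : set R).
Hypothesis cf : {within I, continuous f}.

(** One modulus of continuity serves all contours of f, whatever their errors;
    this is what makes limits of contours continuous. *)
Lemma contour_modulus (k : R) : 0 < k -> exists2 d : R, 0 < d &
  (forall s t, I s -> I t -> `|s - t| < d -> mdist (f s) (f t) <= k /\
     forall phi e g, contour f phi e g -> `|g s - g t| <= 2 * k + e).
Proof.
move=> k0.
have [d d0 dP] := compact_unif_continuous (@segment_compact _ 0 1) cf k0.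
exists (Num.min d k); first by rewrite lt_min d0.
move=> s t Is It; rewrite lt_min => /andP[std stk].
split; first by apply/ltW/dP.
move=> phi e g [_ _ _ h _].
wlog st : s t Is It std stk / s <= t => [wl|].
  case: (leP s t) => [|/ltW]; first exact: wl.
  by move=> ts; rewrite distrC; apply: wl => //; rewrite distrC.
move: Is It; rewrite !unit_itvE => /andP[s0 _] /andP[_ t1].
have ts : `|s - t| = t - s by rewrite distrC ger0_norm// subr_ge0.
rewrite ts in std stk.
apply: le_trans (h s t k s0 st t1 _) _; last by lra.
move=> u v /andP[su ut] /andP[sv vt]; apply/ltW/dP; rewrite ?unit_itvE.
- by rewrite (le_trans s0 su) (le_trans ut t1).
- by rewrite (le_trans s0 sv) (le_trans vt t1).
- by apply: le_lt_trans std; rewrite /= ler_norml; lra.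
Qed.

(** The limit is pointwise along an ultrafilter on the indices, and the time r
    for the limit is the limit of the times r for the approximations. The common
    modulus controls the difference between g_n (r_n) and g_n (r). *)
Lemma contour_limit phi : is_gauge f phi ->
  (forall e, 0 < e -> exists g, contour f phi e g) ->
  exists g, contour f phi 0 g.
Proof.
move=> gphi H.
have /choice[g_ gP] (n : nat) : exists g, contour f phi n.+1%:R^-1 g.
  by apply: H; rewrite invr_gt0.
have [U [uU ooU]] := @ultraFilterLemma nat \oo _.
have pU : ProperFilter U by exact: ultra_proper.
have small (k : R) : 0 < k -> U [set n : nat | n.+1%:R^-1 < k :> R].
  move=> k0; apply: ooU; exact: near_infty_natSinv_lt (PosNum k0).
have /choice[g gU] (s : R) : exists p, I s -> 0 <= p <= 1 /\
    forall k, 0 < k -> U [set n | `|g_ n s - p| < k].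
  have [Is|nI] := pselect (I s); last by exists 0.
  have [|p p01 pU'] := @ultrafilter_limit R nat U (fun n => g_ n s) uU _;
    last by exists p.
  by move=> n; have [h _ _ _ _] := gP n; apply: h; rewrite -unit_itvE.
have glim s : I s -> forall k, 0 < k -> U [set n | `|g_ n s - g s| < k].
  by move=> /gU[].
have eqU s c : I s -> (forall n, g_ n s = c) -> g s = c.
  move=> Is gc; apply/eqP; rewrite -subr_eq0 -normr_le0; apply/ler_addgt0Pr => k k0.
  by have [n /=] := filter_ex (glim s Is k k0); rewrite gc distrC add0r => /ltW.
have I0 : I 0 by exact: unit_itv0.
have I1 : I 1 by exact: unit_itv1.
exists g; split.
- by move=> s; rewrite -unit_itvE => /gU[].
- by apply: eqU => // n; have [] := gP n.
- by apply: eqU => // n; have [] := gP n.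
- move=> s t D s0 st t1 fD; rewrite addr0; apply/ler_addgt0Pr => k k0.
  have Is : I s by rewrite unit_itvE s0 (le_trans st).
  have It : I t by rewrite unit_itvE t1 (le_trans s0).
  have k3 : 0 < k / 3 by rewrite divr_gt0.
  have [n [/= [h1 h2] h3]] := filter_ex (filterI
    (filterI (glim s Is _ k3) (glim t It _ k3)) (small _ k3)).
  have [_ _ _ h _] := gP n; have := h s t D s0 st t1 fD.
  move: (n.+1%:R^-1) h1 h2 h3 => q; rewrite !ltr_norml !ler_norml.
  by move=> /andP[? ?] /andP[? ?] ? /andP[? ?]; lra.
- move=> s t s0 st t1.
  have Is : I s by rewrite unit_itvE s0 (le_trans st).
  have It : I t by rewrite unit_itvE t1 (le_trans s0).
  have /choice[r_ rP] (n : nat) : exists r, [/\ s <= r <= t,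
        phi (mdist (f s) (f r)) <= g_ n s - g_ n r + n.+1%:R^-1 &
        phi (mdist (f t) (f r)) <= g_ n t - g_ n r + n.+1%:R^-1].
    by have [_ _ _ _] := gP n; apply.
  have rst n : s <= r_ n <= t by have [] := rP n.
  have rI n : I (r_ n) by have /andP[? ?] := rst n; rewrite unit_itvE; lra.
  have [|r _ rU] := @ultrafilter_limit R nat U r_ uU.
    by move=> n; have := rI n; rewrite unit_itvE.
  have rst' : s <= r <= t.
    apply/andP; split; apply/ler_addgt0Pr => k k0;
    have [n /=] := filter_ex (rU _ k0); have /andP[? ?] := rst n;
    by rewrite ltr_norml => /andP[? ?]; lra.
  have Ir : I r by rewrite unit_itvE; lra.
  have key u : I u -> (forall n, phi (mdist (f u) (f (r_ n))) <=
        g_ n u - g_ n (r_ n) + n.+1%:R^-1) ->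
      phi (mdist (f u) (f r)) <= g u - g r + 0.
    move=> Iu hu; apply/ler_addgt0Pr => k k0; rewrite addr0.
    have k8 : 0 < k / 8 by rewrite divr_gt0.
    have [d d0 dP] := contour_modulus k8.
    have [n /= [[[h1 h2] h3] h4]] := filter_ex (filterI (filterI (filterI
      (glim u Iu _ k8) (glim r Ir _ k8)) (small _ k8)) (rU _ d0)).
    have [dr /(_ _ _ _ (gP n)) gr] := dP _ _ (rI n) Ir h4.
    have := hu n.
    have : phi (mdist (f u) (f r)) <= phi (mdist (f u) (f (r_ n))) + k / 8.
      apply: (gauge_lipschitz gphi); last exact: ltW.
      by have := metric_triangle (f u) (f (r_ n)) (f r); lra.
    move: (n.+1%:R^-1) h1 h2 h3 gr => q; rewrite !ltr_norml !ler_norml.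
    by move=> /andP[? ?] /andP[? ?] ? /andP[? ?] ? ?; lra.
  exists r; split => //; apply: key => // n; by have [] := rP n.
Qed.

End limit.

(** * The contraction along a contour *)

Section homotopy.
Context {R : realType} {X : metricType R}.
Variables (f : R -> X) (phi g : R -> R).
Notation I := (`[0, 1]%classic : set R).
Hypotheses (cf : {within I, continuous f}) (gphi : is_gauge f phi).
Hypothesis fg : contour f phi 0 g.

Definition last_below (s u : R) : R := sup [set r | 0 <= r <= s /\ g r <= u].

Let g_mod (k : R) : 0 < k -> exists2 d : R, 0 < d &
  forall s t, I s -> I t -> `|s - t| < d -> `|g s - g t| <= k.
Proof.
move=> k0; have k2 : 0 < k / 2 by rewrite divr_gt0.
have [d d0 dP] := contour_modulus cf k2; exists d => // s t Is It st.
by have [_ /(_ _ _ _ fg)] := dP _ _ Is It st; lra.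
Qed.

Let g0 : g 0 = 0. Proof. by case: fg. Qed.

Let has_sup_below (s u : R) : 0 <= s -> 0 <= u ->
  has_sup [set r | 0 <= r <= s /\ g r <= u].
Proof.
move=> s0 u0; split; first by exists 0; rewrite /= g0 lexx s0.
by exists s => r /= [/andP[]].
Qed.

Lemma last_below_ge (s u r : R) : 0 <= u -> 0 <= r <= s -> g r <= u ->
  r <= last_below s u.
Proof.
move=> u0 /andP[r0 rs] gr; apply: ub_le_sup; last by rewrite /= r0 rs.
by have [] := has_sup_below (le_trans r0 rs) u0.
Qed.

Lemma last_below_itv (s u : R) : 0 <= s -> 0 <= u -> 0 <= last_below s u <= s.
Proof.
move=> s0 u0; rewrite last_below_ge ?lexx ?g0//=.
have [ne _] := has_sup_below s0 u0.
by apply: ge_sup => // r /= [/andP[]].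
Qed.

Lemma last_below_id (s u : R) : 0 <= s -> 0 <= u -> g s <= u -> last_below s u = s.
Proof.
move=> s0 u0 gs; apply/eqP; rewrite eq_le last_below_ge ?s0 ?lexx// andbT.
by have /andP[] := last_below_itv s0 u0.
Qed.

(** The height at that time is u when the ceiling u is below g s, by the
    intermediate value property; otherwise the time is s itself. *)
Lemma contour_last_below (s u : R) : I s -> 0 <= u ->
  g (last_below s u) = Num.min u (g s).
Proof.
rewrite unit_itvE => /andP[s0 s1] u0; set l := last_below s u.
have /andP[l0 ls] : 0 <= l <= s by exact: last_below_itv.
have Il : I l by rewrite unit_itvE l0 (le_trans ls).
have glu : g l <= u.
  apply/ler_addgt0Pr => k /g_mod[d d0 dP].
  have [r [/andP[r0 rs] gr] lr] := sup_adherent d0 (has_sup_below s0 u0).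
  have rl : r <= l by apply: last_below_ge => //; rewrite r0.
  have Ir : I r by rewrite unit_itvE r0 (le_trans rs).
  have := dP l r Il Ir; rewrite ger0_norm ?subr_ge0// ler_norml.
  rewrite -/(last_below s u) -/l in lr.
  have lrd : l - r < d by lra.
  by move=> /(_ lrd)/andP[? ?]; lra.
have [ls'|ls'] := eqVneq l s; first by rewrite ls' in glu *; rewrite (min_idPr glu).
have lts : l < s by rewrite lt_neqAle ls'.
have above r : l < r -> r <= s -> u < g r.
  move=> lr rs; rewrite ltNge; apply/negP => gr.
  have : r <= l by apply: last_below_ge gr => //; rewrite rs (le_trans l0 (ltW lr)).
  by rewrite leNgt lr.
rewrite (min_idPl (ltW (above _ lts (lexx s)))); apply/eqP; rewrite eq_le glu /=.
apply/ler_addgt0Pr => k /g_mod[d d0 dP].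
have [r [lr rs rd]] : exists r, [/\ l < r, r <= s & r - l < d].
  exists (Num.min s (l + d / 2)); rewrite lt_min lts ge_min lexx; split => //.
    by rewrite ltrDl divr_gt0.
  have : Num.min s (l + d / 2) <= l + d / 2 by rewrite ge_min lexx orbT.
  by lra.
have Ir : I r by rewrite unit_itvE (le_trans l0 (ltW lr)) (le_trans rs).
have := dP _ _ Ir Il; rewrite ger0_norm ?subr_ge0 ?(ltW lr)// => /(_ rd).
by rewrite ler_norml => /andP[? ?]; have := above _ lr rs; lra.
Qed.

Lemma contour_above_last_below (s u r : R) : I s -> 0 <= u ->
  last_below s u <= r <= s -> g (last_below s u) <= g r.
Proof.
move=> Is u0 /andP[lr rs]; have [->//|lr'] := eqVneq (last_below s u) r.
rewrite contour_last_below// ge_min; apply/orP; left.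
rewrite leNgt; apply/negP => gr.
move: Is; rewrite unit_itvE => /andP[s0 _].
have /andP[l0 _] := last_below_itv s0 u0.
have : r <= last_below s u.
  by apply: last_below_ge (ltW gr) => //; rewrite (le_trans l0 lr).
by rewrite leNgt lt_neqAle lr' lr.
Qed.

(** Let l and l' be the times last_below s u and last_below t v, with l <= l'.
    Their heights are close by [contour_last_below], and g is not much lower
    anywhere between them: it is at least g l on [l, s], and what remains of
    [l, l'] lies between the close times s and t. So the time r that the contour
    gives for l and l' has almost their height, and f r is close to both f l and
    f l'. *)
Lemma last_below_unif (e : R) : 0 < e -> exists2 d : R, 0 < d &
  forall s t u v, I s -> I t -> 0 <= u -> 0 <= v -> `|s - t| < d -> `|u - v| < d ->
    mdist (f (last_below s u)) (f (last_below t v)) < e.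
Proof.
move=> e0; have e20 : 0 < e / 2 by rewrite divr_gt0.
have c0 := gauge_gt0 gphi e20; set c := phi (e / 2) in c0.
have c4 : 0 < c / 4 by rewrite divr_gt0.
have [d d0 dP] := g_mod c4.
exists (Num.min d (c / 4)); first by rewrite lt_min d0.
move=> s t u v Is It u0 v0; rewrite !lt_min => /andP[std _] /andP[_ uvc].
wlog st : s t u v Is It u0 v0 std uvc / last_below s u <= last_below t v => [wl|].
  case: (leP (last_below s u) (last_below t v)) => [|/ltW]; first exact: wl.
  by move=> ts; rewrite metric_sym; apply: wl => //; rewrite distrC.
have gst := dP _ _ Is It std.
have gl : `|g (last_below s u) - g (last_below t v)| <= c / 4.
  rewrite !contour_last_below//.
  move: gst uvc; rewrite !minEle !ltr_norml !ler_norml => /andP[? ?] /andP[? ?].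
  by case: (leP u _); case: (leP v _); lra.
have [s0 t1] : 0 <= s /\ t <= 1.
  by move: Is It; rewrite !unit_itvE => /andP[-> _] /andP[_ ->].
have t0 : 0 <= t by move: It; rewrite unit_itvE => /andP[].
have /andP[ls0 lss] := last_below_itv s0 u0.
have /andP[lt0 ltt] := last_below_itv t0 v0.
have [_ _ _ _ /(_ _ _ ls0 st (le_trans ltt t1))[r [/andP[lr rl] h1 h2]]] := fg.
have gr : g (last_below s u) - c / 4 <= g r.
  case: (leP r s) => rs.
    have := @contour_above_last_below s u r Is u0; rewrite lr rs => /(_ isT); lra.
  have Ir : I r.
    by rewrite unit_itvE (le_trans s0 (ltW rs)) (le_trans rl (le_trans ltt t1)).
  have := dP _ _ Is Ir; rewrite contour_last_below//.
  have : `|s - r| < d.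
    apply: le_lt_trans std; rewrite distrC (distrC s).
    by rewrite !ger0_norm ?subr_ge0 ?(ltW rs)//; lra.
  move=> + h => /h; rewrite ler_norml => /andP[h3 h4].
  have : Num.min u (g s) <= g s by rewrite ge_min lexx orbT.
  lra.
have near x : phi (mdist x (f r)) < c -> mdist x (f r) < e / 2.
  move=> h; rewrite ltNge; apply/negP => /(gauge_le gphi) h'.
  by move: h; rewrite ltNge h'.
have /near a1 : phi (mdist (f (last_below s u)) (f r)) < c by lra.
have /near a2 : phi (mdist (f (last_below t v)) (f r)) < c.
  by move: gl; rewrite ler_norml => /andP[? ?]; lra.
have := metric_triangle (f (last_below s u)) (f r) (f (last_below t v)).
by rewrite [mdist (f r) _]metric_sym; lra.
Qed.

(** The ceiling at time t of the homotopy is 1 - t. Points of height 0 are all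
    mapped to f 0, since a contour sees them as one point. *)
Lemma contour_null_homotopic : path_homotopic f (cst (f 0)).
Proof.
have [g01 _ g1 _ gP] := fg.
exists (fun p => f (last_below p.1 (1 - p.2))); split.
- apply/subspace_continuousP => -[s t] [Is It].
  apply/cvg_ballP => e e0; rewrite near_withinE.
  have [d d0 dP] := last_below_unif e0.
  apply/nbhs_ballP; exists d => //= -[s' t'] [/= ss' tt'] [Is' It'].
  rewrite ballEmdist /=; apply: dP => //.
  + by have : I t := It; rewrite unit_itvE /=; lra.
  + by have : I t' := It'; rewrite unit_itvE /=; lra.
  + by rewrite (_ : 1 - t - (1 - t') = t' - t) 1?distrC//; lra.
- move=> s; rewrite unit_itvE /= subr0 => Is.
  rewrite last_below_id//; first by case/andP: Is.
  by have /andP[] := g01 _ Is.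
- move=> s Is /=; rewrite subrr.
  move: (Is); rewrite unit_itvE => /andP[s0 s1].
  have gl := contour_last_below Is (lexx 0).
  have /andP[l0 ls] := last_below_itv s0 (lexx 0).
  have [r [/andP[r0 rl] h1 h2]] := gP _ _ (lexx 0) l0 (le_trans ls s1).
  have /andP[gr0 _] : 0 <= g r <= 1.
    by apply: g01; rewrite r0 (le_trans rl (le_trans ls s1)).
  have eqr x : phi (mdist x (f r)) <= 0 -> x = f r.
    move=> h; apply: mdist_positivity; apply/eqP; rewrite eq_le mdist_ge0 andbT leNgt.
    by apply/negP => /(gauge_gt0 gphi); rewrite ltNge h.
  rewrite g0 in h1; rewrite (eqr (f 0)); last by lra.
  rewrite -(eqr (f (last_below s 0)))//.
  have : Num.min 0 (g s) <= 0 by rewrite ge_min lexx.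
  lra.
- move=> t; rewrite unit_itvE /= => /andP[t0 t1].
  have u0 : 0 <= 1 - t by rewrite subr_ge0.
  rewrite !last_below_id ?lexx ?ler01 ?g0 ?g1//.
Qed.

End homotopy.

(** * Compact spaces and the theorem *)

Section compact_dimension.
Context {R : realType} (X : metricType R).

(** The Lebesgue number lemma. The point x0 provides a member of U that contains
    the empty set, whose diameter is -oo. *)
Lemma compact_uniform_cover (x0 : X) (U : set (set X)) :
  compact [set: X] -> open_cover U -> uniform_open_cover U.
Proof.
move=> /compact_near_coveringP cX oU; split=> //; have [Uo Uc] := oU.
pose P (d : R) (x : X) := exists2 B, U B & ball x d `<=` B.
have : \forall d \near 0^'+, [set: X] `<=` P d.
  apply: cX => x _.
  have [B UB Bx] : (\bigcup_(A in U) A) x by rewrite Uc.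
  have [r /= r0 rB] : nbhs_ball x B.
    by apply/nbhs_ballP; exact: open_nbhs_nbhs (conj (Uo _ UB) Bx).
  exists (ball x (r / 2), [set d : R | 0 < d < r / 2]).
    split => /=; first by apply: nbhsx_ballx; rewrite divr_gt0.
    near=> d; apply/andP; split; near: d; first exact: nbhs_right_gt.
    by apply: nbhs_right_lt; rewrite divr_gt0.
  move=> [y d] /= [xy /andP[d0 dr]]; exists B => // z yz; apply: rB.
  rewrite (splitr r); apply: (ball_triangle xy).
  by apply: le_ball yz; exact: ltW.
move=> h; near (0 : R)^'+ => d; exists d => // A Ad.
have dP : [set: X] `<=` P d by near: d; exact: h.
have [->|/set0P[x Ax]] := eqVneq A set0.
  by have [B UB _] := dP x0 I; exists B.
have [B UB xB] := dP x I; exists B => // y Ay; apply: xB.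
by rewrite ballEmdist /=; exact: diameter_lt Ad Ax Ay.
Unshelve. all: by end_near. Qed.

Lemma compact_uniform_dim_le (x0 : X) n : compact [set: X] ->
  uniform_dim_le X n <-> topological_dim_le X n.
Proof.
move=> cX; split=> h U.
  move=> /(compact_uniform_cover x0 cX)/h[V [[oV _] VU Vn]].
  by exists V.
move=> [/h[V [oV VU Vn]] _]; exists V; split=> //.
exact: compact_uniform_cover.
Qed.

(** The empty family is a cover of the empty space, which therefore is not
    one-dimensional. *)
Lemma empty_dim n : ~ inhabited X -> topological_dim_le X n.
Proof.
move=> X0 U _; exists set0; split.
- by split=> //; apply/seteqP; split=> // x _; case: X0.
- by [].
- by move=> x; case: X0.
Qed.

Lemma compact_uniformly_one_dimensional : compact [set: X] ->
  topologically_one_dimensional X -> uniformly_one_dimensional X.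
Proof.
move=> cX [X1 X0].
have [[x0]|/empty_dim e] := pselect (inhabited X); last by case: X0; exact: e.
by split; rewrite (compact_uniform_dim_le x0).
Qed.

End compact_dimension.

Lemma pi_cl_trivial (R : realType) (X : metricType R) (b : X) :
  uniform_dim_le X 1 -> pi_cl b = [set 1%g] :> set (pi1 b).
Proof.
move=> X1; apply/seteqP; split=> [c|_ ->]; last exact: pi_cl1.
elim/quotW: c => f fN.
have cf := loop_continuous (l := f).
have [phi gphi] := gauge_exists cf.
have [g fg] : exists g, contour f phi 0 g.
  apply: (contour_limit cf gphi) => e e0.
  by apply: (contour_exists X1 _ gphi e0) => d d0; exact: fN.
by apply/pi1P; have := contour_null_homotopic cf gphi fg; rewrite loop_start.
Qed.

Theorem lemma3p12 (R : realType) (X : metricType R) (hX : geodesic_space X) :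
  (compact [set: X] -> topologically_one_dimensional X ->
     uniformly_one_dimensional X) /\
  (uniformly_one_dimensional X -> forall b : X,
     pi_cl b = [set 1%g] :> set (pi1 b) /\
     group_isomorphism (pi1bar_proj b)).
Proof.
split; first exact: compact_uniformly_one_dimensional.
move=> [X1 _] b; have cl1 := pi_cl_trivial b X1; split=> //; split.
  exact: quotient_projM.
exists repr => [x|c]; last exact: quotient_projK.
have : (pi_cl b : set (pi1 b)) ((repr (pi1bar_proj b x))^-1 * x)%g.
  exact: repr_quotient_proj.
rewrite cl1 /= => yx; apply: (@mulgI _ (repr (pi1bar_proj b x))^-1%g).
by rewrite mulVg yx.
Qed.
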